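(* If $G$ is a finitely generated group with infinitely many ends, then the dimension of $H^2_b(G;\mathbb{R})$ as a real vector space is exactly $2^{\aleph_0}$.
   Context: $H^2_b(G;\mathbb{R})$ denotes the second bounded cohomology of $G$ with real coefficients. The number of ends of a finitely generated group is the number of ends of its Cayley graph with respect to a finite generating set. *)

(* Defs.v *)
From Stdlib Require Import Reals List Relations.
Open Scope R_scope.

Record Group := {
  carrier :> Type;
  gmul : carrier -> carrier -> carrier;
  ginv : carrier -> carrier;
  gone : carrier;
  gmul_assoc : forall x y z, gmul x (gmul y z) = gmul (gmul x y) z;
  gmul_1l : forall x, gmul gone x = x;
  gmul_Vl : forall x, gmul (ginv x) x = gone
}.

Definition eval_word (G : Group) (w : list (bool * G)) : G :=
  fold_right (fun (p : bool * G) (acc : G) => gmul G (if fst p then snd p else ginv G (snd p)) acc)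
    (gone G) w.

Definition generates (G : Group) (S : list G) : Prop :=
  forall g : G, exists w : list (bool * G),
    (forall p, In p w -> In (snd p) S) /\ g = eval_word G w.

Definition finitely_generated (G : Group) : Prop :=
  exists S : list G, generates G S.

Definition cayley_adj (G : Group) (S : list G) (g h : G) : Prop :=
  exists s, In s S /\ (h = gmul G g s \/ g = gmul G h s).

Definition conn_outside (G : Group) (S : list G) (K : list G) : G -> G -> Prop :=
  clos_refl_trans G (fun a b => cayley_adj G S a b /\ ~ In a K /\ ~ In b K).

Definition infinite_component (G : Group) (S : list G) (K : list G) (g : G) : Prop :=
  ~ In g K /\
  ~ (exists L : list G, forall h, conn_outside G S K g h -> In h L).

Definition infinitely_many_ends (G : Group) (S : list G) : Prop :=
  forall n : nat, exists (K : list G) (f : nat -> G),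
    (forall i, (i < n)%nat -> infinite_component G S K (f i)) /\
    (forall i j, (i < j)%nat -> (j < n)%nat -> ~ conn_outside G S K (f i) (f j)).

(* Bounded cohomology with trivial real coefficients (inhomogeneous cochains). *)
Definition bounded1 (G : Group) (f : G -> R) : Prop :=
  exists M, forall g, Rabs (f g) <= M.
Definition bounded2 (G : Group) (c : G -> G -> R) : Prop :=
  exists M, forall g h, Rabs (c g h) <= M.

Definition delta1 (G : Group) (f : G -> R) (g h : G) : R :=
  f h - f (gmul G g h) + f g.
Definition delta2 (G : Group) (c : G -> G -> R) (g h k : G) : R :=
  c h k - c (gmul G g h) k + c g (gmul G h k) - c g h.

Definition bcocycle2 (G : Group) (c : G -> G -> R) : Prop :=
  bounded2 G c /\ forall g h k, delta2 G c g h k = 0.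
Definition bcoboundary2 (G : Group) (c : G -> G -> R) : Prop :=
  exists f, bounded1 G f /\ forall g h, c g h = delta1 G f g h.

Definition lin_comb {I : Type} (G : Group) (l : list I) (a : I -> R)
  (b : I -> G -> G -> R) (g h : G) : R :=
  fold_right (fun t acc => a t * b t g h + acc) 0 l.

(* The classes [b i], i : I, form a basis of H^2_b(G;R) = bounded cocycles /
   bounded coboundaries. *)
Definition Hb2_basis {I : Type} (G : Group) (b : I -> G -> G -> R) : Prop :=
  (forall i, bcocycle2 G (b i)) /\
  (forall (l : list I) (a : I -> R), NoDup l ->
     bcoboundary2 G (lin_comb G l a b) -> forall t, In t l -> a t = 0) /\
  (forall c, bcocycle2 G c -> exists (l : list I) (a : I -> R),
     bcoboundary2 G (fun g h => c g h - lin_comb G l a b g h)).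

Definition Hb2_dim_continuum (G : Group) : Prop :=
  exists b : R -> G -> G -> R, Hb2_basis G b.

(* Main.v *)
(* Colour the group so that Cayley graph edges outside a finite connected set K
   preserve colours, and let omega be a bounded antisymmetric function of two
   colours.  Then f(h) = sum_g omega(chi g, chi (g h)) is a finite sum and a
   quasimorphism: its coboundary at (x, y) only involves translates of K that
   separate 1, x and xy into three colours, and any two of these must meet.

   Infinitely many ends give such a K whose complement splits into three infinite
   colours, and from it a ping-pong pair a, b that maps the complement of V into
   U, has aU and bU disjoint, and is not distinguished by homomorphisms to R.  For
   a word w in a, b, the colours V and wU give a Brooks-type counting
   quasimorphism f_w.  If a translate of this pattern occurs, in either
   direction, along a power of u, then w is, up to finitely many factors on both
   sides, a subword of a power of u or the inverse of one.  There are 2^n words of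
   length n and only polynomially many such subwords, so w_n and u_n can be chosen
   inductively with f_(w_n) zero on the powers of a and of u_m for m < n, and
   growing linearly on the powers of u_n.  The combinations sum_n s^n/D_n f_(w_n),
   with D_n bounding the defect of f_(w_n) and 0 < s < 1, then have independent
   classes: evaluation on the powers of u_n is triangular, and a homomorphism that
   is bounded on the powers of a vanishes on every u_n.

   Conversely G is countable, so there are at most continuum many cochains, and a
   maximal independent family of cocycles is in bijection with R. *)
From mathcomp Require Import ssreflect.
From mathcomp Require classical_sets.
From Stdlib Require Import Reals List Relations Lra Lia Permutation Cantor.
From Stdlib Require Import Classical ClassicalEpsilon FunctionalExtensionality.
Require Import Defs.
Import ListNotations.

Notation "x ** y" := (gmul _ x y) (at level 40, left associativity).
Notation inv x := (ginv _ x).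
Notation one := (gone _).

(** * Elementary group identities *)

Lemma mulgV {G : Group} (x : G) : x ** inv x = one.
Proof.
rewrite -{1}(gmul_1l G (x ** inv x)) -{1}(gmul_Vl G (inv x)).
by rewrite -(gmul_assoc G _ (inv x)) (gmul_assoc G (inv x)) gmul_Vl gmul_1l gmul_Vl.
Qed.

Lemma mulg1 {G : Group} (x : G) : x ** one = x.
Proof. by rewrite -(gmul_Vl G x) gmul_assoc mulgV gmul_1l. Qed.

Lemma mulgK {G : Group} (x y : G) : x ** y ** inv y = x.
Proof. by rewrite -gmul_assoc mulgV mulg1. Qed.

Lemma mulgVK {G : Group} (x y : G) : x ** inv y ** y = x.
Proof. by rewrite -gmul_assoc gmul_Vl mulg1. Qed.

Lemma mulg_lcancel {G : Group} (x y z : G) : x ** y = x ** z -> y = z.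
Proof.
by move=> H; rewrite -(gmul_1l G y) -(gmul_1l G z) -(gmul_Vl G x) -!gmul_assoc H.
Qed.

Lemma mulg_rcancel {G : Group} (x y z : G) : y ** x = z ** x -> y = z.
Proof. by move=> H; rewrite -(mulgK y x) H mulgK. Qed.

Lemma invgK {G : Group} (x : G) : inv (inv x) = x.
Proof. by apply: (mulg_lcancel (inv x)); rewrite mulgV gmul_Vl. Qed.

Lemma invMg {G : Group} (x y : G) : inv (x ** y) = inv y ** inv x.
Proof.
by apply: (mulg_lcancel (x ** y)); rewrite mulgV gmul_assoc mulgK mulgV.
Qed.

Lemma invg1 {G : Group} : inv one = one :> G.
Proof. by rewrite -{2}(mulgV one) gmul_1l. Qed.

Ltac gsimp :=
  rewrite ?invMg ?invgK ?gmul_assoc;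
  repeat first [rewrite mulgK | rewrite mulgVK | rewrite gmul_Vl | rewrite mulgV
    | rewrite gmul_1l | rewrite mulg1 | rewrite invgK | rewrite invg1].

Definition gprod {G : Group} (l : list G) : G := fold_right (gmul G) one l.

Lemma gprod_app {G : Group} (l m : list G) : gprod (l ++ m) = gprod l ** gprod m.
Proof.
elim: l => [|x l IH] /=; first by rewrite gmul_1l.
by rewrite IH gmul_assoc.
Qed.

Lemma gprod_inv {G : Group} (l : list G) : inv (gprod l) = gprod (map (ginv G) (rev l)).
Proof.
elim: l => [|x l IH] /=; first by rewrite invg1.
by rewrite map_app gprod_app /= mulg1 invMg IH.
Qed.

(** * Sums of finitely supported functions *)

Definition lsum {T : Type} (phi : T -> R) (l : list T) : R :=
  fold_right (fun x acc => phi x + acc) 0 l.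

Definition supp_in {T : Type} (phi : T -> R) (l : list T) : Prop :=
  forall x, phi x <> 0 -> In x l.

(** By [lsum_supp] the value is the same for every duplicate-free list covering the support; 0 is a
    junk value for infinite support. *)
Definition fsum {T : Type} (phi : T -> R) : R :=
  match excluded_middle_informative (exists l, NoDup l /\ supp_in phi l) with
  | left H => lsum phi (proj1_sig (constructive_indefinite_description _ H))
  | right _ => 0
  end.

Lemma nodup_cover {T : Type} (l : list T) :
  exists l', NoDup l' /\ (forall x, In x l' <-> In x l) /\ (length l' <= length l)%nat.
Proof.
pose d (x y : T) := excluded_middle_informative (x = y).
exists (nodup d l); split; [exact: NoDup_nodup|split].
  by move=> x; rewrite nodup_In.
by apply: NoDup_incl_length; [exact: NoDup_nodup|move=> x; rewrite nodup_In].
Qed.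

Lemma lsum_perm {T : Type} (phi : T -> R) l m : Permutation l m -> lsum phi l = lsum phi m.
Proof. by elim=> //= [x l1 l2 _ -> //|x y l1|l1 l2 l3 _ -> _ -> //]; lra. Qed.

(** Discarding the zeros of [phi] turns both lists into duplicate-free enumerations of the exact
    support, hence into permutations of each other. *)
Lemma lsum_supp {T : Type} (phi : T -> R) l m :
  NoDup l -> NoDup m -> supp_in phi l -> supp_in phi m -> lsum phi l = lsum phi m.
Proof.
pose nz x := match Req_EM_T (phi x) 0 with left _ => false | right _ => true end.
have nzP x : nz x = true <-> phi x <> 0 by rewrite /nz; case: Req_EM_T.
have E k : lsum phi k = lsum phi (filter nz k).
  elim: k => //= x k ->; rewrite /nz; case: Req_EM_T => /= [->|?] //; lra.
move=> Nl Nm Sl Sm; rewrite (E l) (E m); apply: lsum_perm.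
apply: NoDup_Permutation; try exact: NoDup_filter.
move=> x; rewrite !filter_In nzP; split=> -[_ H]; split=> //; [exact: Sm|exact: Sl].
Qed.

Lemma fsumE {T : Type} (phi : T -> R) l : NoDup l -> supp_in phi l -> fsum phi = lsum phi l.
Proof.
move=> Nl Sl; rewrite /fsum; case: excluded_middle_informative => [H|[]]; last by exists l.
case: constructive_indefinite_description => m [Nm Sm] /=.
exact: lsum_supp.
Qed.

Lemma lsum_add {T : Type} (phi psi : T -> R) l :
  lsum (fun x => phi x + psi x) l = lsum phi l + lsum psi l.
Proof. elim: l => /= [|x l ->]; lra. Qed.

Lemma lsum_scale {T : Type} c (phi : T -> R) l :
  lsum (fun x => c * phi x) l = c * lsum phi l.
Proof. elim: l => /= [|x l ->]; lra. Qed.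

Lemma lsum_ext {T : Type} (phi psi : T -> R) l :
  (forall x, In x l -> phi x = psi x) -> lsum phi l = lsum psi l.
Proof.
elim: l => //= x l IH H; rewrite H; last by left.
by rewrite IH // => y Hy; apply: H; right.
Qed.

Lemma lsum_cons {T : Type} (phi : T -> R) x l : lsum phi (x :: l) = phi x + lsum phi l.
Proof. by []. Qed.

Lemma lsum_app {T : Type} (phi : T -> R) l m : lsum phi (l ++ m) = lsum phi l + lsum phi m.
Proof. by elim: l => /= [|x l ->]; lra. Qed.

Lemma lsum_le {T : Type} (phi psi : T -> R) l :
  (forall x, Rabs (phi x) <= psi x) -> Rabs (lsum phi l) <= lsum psi l.
Proof.
move=> H; elim: l => [|x l IH] /=; first by rewrite Rabs_R0; lra.
by have := Rabs_triang (phi x) (lsum phi l); have := H x; lra.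
Qed.

Lemma lsum_bound {T : Type} (phi : T -> R) l c :
  (forall x, Rabs (phi x) <= c) -> Rabs (lsum phi l) <= c * INR (length l).
Proof.
move=> H; elim: l => [|x l IH] /=; first by rewrite Rabs_R0; lra.
have := Rabs_triang (phi x) (lsum phi l); have := H x.
rewrite -/(length _) -/(INR (S (length l))) S_INR; lra.
Qed.

Lemma fsum_add {T : Type} (phi psi : T -> R) l m :
  supp_in phi l -> supp_in psi m -> fsum (fun x => phi x + psi x) = fsum phi + fsum psi.
Proof.
move=> Sl Sm; have [k [Nk [Hk _]]] := nodup_cover (l ++ m).
have I1 x : In x l -> In x k by move=> H; apply/Hk/in_or_app; left.
have I2 x : In x m -> In x k by move=> H; apply/Hk/in_or_app; right.
have S : supp_in (fun x => phi x + psi x) k.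
  move=> x H; case: (Req_dec (phi x) 0) => E; last exact/I1/Sl.
  by apply/I2/Sm => E'; apply: H; rewrite E E'; lra.
rewrite (fsumE _ k Nk S) (fsumE phi k Nk) ?(fsumE psi k Nk) ?lsum_add //.
- by move=> x /Sm /I2.
- by move=> x /Sl /I1.
Qed.

Lemma fsum_scale {T : Type} c (phi : T -> R) l :
  supp_in phi l -> fsum (fun x => c * phi x) = c * fsum phi.
Proof.
move=> Sl; have [k [Nk [Hk _]]] := nodup_cover l.
have S x : phi x <> 0 -> In x k by move=> /Sl /Hk.
rewrite (fsumE phi k Nk S) (fsumE _ k Nk) ?lsum_scale //.
move=> x H; apply: S => E; apply: H; rewrite E; lra.
Qed.

Lemma fsum_bound {T : Type} (phi : T -> R) l c :
  0 <= c -> supp_in phi l -> (forall x, Rabs (phi x) <= c) ->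
  Rabs (fsum phi) <= c * INR (length l).
Proof.
move=> c0 Sl H; have [k [Nk [Hk Lk]]] := nodup_cover l.
rewrite (fsumE _ k) //; last by move=> x /Sl /Hk.
apply: Rle_trans (lsum_bound _ _ _ H) _.
by apply: Rmult_le_compat_l => //; apply: le_INR.
Qed.

Lemma fsum_eq0 {T : Type} (phi : T -> R) : (forall x, phi x = 0) -> fsum phi = 0.
Proof. by move=> H; rewrite (fsumE _ [] (NoDup_nil _)) // => x /(_ (H x)). Qed.

Lemma fsum_ge {T : Type} (phi : T -> R) l m :
  supp_in phi l -> (forall x, 0 <= phi x) -> NoDup m -> (forall x, In x m -> 1 <= phi x) ->
  INR (length m) <= fsum phi.
Proof.
move=> Sl P Nm Hm; have [k [Nk [Hk _]]] := nodup_cover l.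
rewrite (fsumE _ k) //; last by move=> x /Sl /Hk.
have {Hk Sl l} I : incl m k.
  by move=> x /Hm H; apply/Hk; apply: Sl; lra.
move: k Nk Nm Hm I; induction m as [|x m IH] => k Nk Nm Hm I.
  by elim: (k) => /= [|y k' ?]; [|have := P y]; lra.
have [k1 [k2 Ek]] : exists k1 k2, k = k1 ++ x :: k2 by apply: in_split; apply: I; left.
rewrite (lsum_perm _ k (x :: k1 ++ k2)); last first.
  by rewrite Ek; apply: Permutation_sym; exact: Permutation_middle.
rewrite [length _]/= S_INR [lsum _ _]/= -/(lsum phi (k1 ++ k2)).
have /= := Hm x (or_introl eq_refl).
have : INR (length m) <= lsum phi (k1 ++ k2); last by lra.
have [Nx Nm'] : ~ In x m /\ NoDup m by apply/NoDup_cons_iff.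
apply: IH => //.
- by rewrite Ek in Nk; exact: NoDup_remove_1 Nk.
- by move=> y Hy; apply: Hm; right.
move=> y Hy; have := I y (or_intror Hy); rewrite Ek in_app_iff => -[H|[E|H]].
- by apply: in_or_app; left.
- by case: Nx; rewrite E.
- by apply: in_or_app; right.
Qed.

Lemma lsum_map {T T' : Type} (h : T -> T') (phi : T' -> R) l :
  lsum phi (map h l) = lsum (fun x => phi (h x)) l.
Proof. by elim: l => //= x l ->. Qed.

Lemma supp_shift {G : Group} (phi : G -> R) (x : G) l :
  supp_in phi l -> supp_in (fun g => phi (g ** x)) (map (fun g => g ** inv x) l).
Proof.
by move=> S g /S H; apply/in_map_iff; exists (g ** x); split=> //; rewrite mulgK.
Qed.

Lemma fsum_shift {G : Group} (phi : G -> R) (x : G) l :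
  supp_in phi l -> fsum (fun g => phi (g ** x)) = fsum phi.
Proof.
move=> Sl; have [k [Nk [Hk _]]] := nodup_cover l.
have S : supp_in phi k by move=> y /Sl /Hk.
rewrite (fsumE phi k) // (fsumE _ (map (fun g => g ** inv x) k)); first last.
- exact: supp_shift.
- by apply: NoDup_map_NoDup_ForallPairs => // y z _ _; exact: mulg_rcancel.
rewrite lsum_map; elim: (k) => //= y k' ->; by rewrite mulgVK.
Qed.

(** * Colourings of the Cayley graph *)

Fixpoint prefixes {A : Type} (l : list A) : list (list A) :=
  [] :: match l with [] => [] | x :: l' => map (cons x) (prefixes l') end.

Lemma length_prefixes {A : Type} (l : list A) : length (prefixes l) = S (length l).
Proof. by elim: l => //= x l IH; rewrite length_map IH. Qed.

Section Cayley.
Context {G : Group}.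
Variable gens : list G.

Definition gen_word (l : list G) : Prop := forall t, In t l -> In t gens.

Hypothesis gens_gen : forall g : G, exists l, gen_word l /\ g = gprod l.
Hypothesis gens_inv : forall t, In t gens -> In (inv t) gens.

(** [K] plays the role of the boundary of the colouring: every edge along which the colour changes
    has an endpoint in [K]. *)
Definition clean {T : Type} (K : G -> Prop) (chi : G -> T) : Prop :=
  forall x t, In t gens -> ~ K x -> ~ K (x ** t) -> chi x = chi (x ** t).

(** Paths of the Cayley graph with all vertices in [P]; the trivial path is allowed at any point,
    even outside [P]. *)
Definition linked (P : G -> Prop) : G -> G -> Prop :=
  clos_refl_trans G (fun a b => exists t, In t gens /\ b = a ** t /\ P a /\ P b).

Definition connected (P : G -> Prop) : Prop := forall a b, P a -> P b -> linked P a b.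

Lemma linked_sym (P : G -> Prop) a b : linked P a b -> linked P b a.
Proof.
elim=> {a b} [a b [t [Ht [-> [Pa Pb]]]]|a|a b c _ H1 _ H2].
- by apply: rt_step; exists (inv t); rewrite mulgK; split; [exact: gens_inv|].
- exact: rt_refl.
- exact: rt_trans H2 H1.
Qed.

Lemma linked_sub (P Q : G -> Prop) a b : (forall x, P x -> Q x) -> linked P a b -> linked Q a b.
Proof.
move=> S; elim=> {a b} [a b [t [Ht [-> [Pa Pb]]]]|a|a b c _ H1 _ H2].
- by apply: rt_step; exists t; do !split=> //; exact: S.
- exact: rt_refl.
- exact: rt_trans H1 H2.
Qed.

Lemma linked_translate (P : G -> Prop) g a b :
  linked P (g ** a) (g ** b) -> linked (fun x => P (g ** x)) a b.
Proof.
suff H x y : linked P x y -> linked (fun x => P (g ** x)) (inv g ** x) (inv g ** y).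
  by move=> /H; rewrite !gmul_assoc !gmul_Vl !gmul_1l.
have E z : g ** (inv g ** z) = z by rewrite gmul_assoc mulgV gmul_1l.
elim=> {x y} [x y [t [Ht [-> [Px Py]]]]|x|x y z _ H1 _ H2].
- by apply: rt_step; exists t; rewrite gmul_assoc -(gmul_assoc G (inv g)) !E.
- exact: rt_refl.
- exact: rt_trans H1 H2.
Qed.

Lemma connected_translate (P : G -> Prop) g :
  connected P -> connected (fun x => P (g ** x)).
Proof. by move=> H a b Pa Pb; apply: linked_translate; apply: H. Qed.

Lemma clean_translate {T : Type} (K : G -> Prop) (chi : G -> T) g :
  clean K chi -> clean (fun x => K (g ** x)) (fun x => chi (g ** x)).
Proof. by move=> H x t Ht; rewrite gmul_assoc; exact: H. Qed.

Lemma clean_linked {T : Type} (K : G -> Prop) (chi : G -> T) a b :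
  clean K chi -> linked (fun x => ~ K x) a b -> chi a = chi b.
Proof.
move=> H; elim=> {a b} [a b [t [Ht [-> [Pa Pb]]]]|a|a b c _ H1 _ H2] //.
- exact: H.
- by rewrite H1.
Qed.

Lemma clean_cross {T : Type} (K : G -> Prop) (chi : G -> T) x l :
  clean K chi -> gen_word l -> chi x <> chi (x ** gprod l) ->
  exists s, In s (prefixes l) /\ K (x ** gprod s).
Proof.
move=> H; elim: l x => [|t l IH] x Hl /=; first by rewrite mulg1.
move=> N; case: (classic (K x)) => Kx.
  by exists []; rewrite /= mulg1; split=> //; left.
case: (classic (chi (x ** t) = chi (x ** t ** gprod l))) => [E|N'].
  case: (classic (K (x ** t))) => Kt.
    exists [t]; rewrite /= mulg1; split=> //; right.
    by apply/in_map_iff; exists []; split=> //; case: (l) => [|? ?]; left.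
  by case: N; rewrite gmul_assoc -E; apply: H => //; apply: Hl; left.
have [|s [Hs Ks]] := IH _ _ N'; first by move=> u Hu; apply: Hl; right.
exists (t :: s); rewrite /= gmul_assoc; split=> //; right.
by apply/in_map_iff; exists s.
Qed.

(** Follow a path from [p] to [z]. Until it meets [K] its colour stays that of [p], which is not
    [c], so it cannot enter [K'] before it has met [K]. *)
Lemma reach_boundary {T : Type} (K K' : G -> Prop) (chi : G -> T) c z p :
  clean K chi -> (forall x, K' x -> chi x = c) -> (forall x, K' x -> ~ K x) ->
  K' z -> chi p <> c -> exists k, K k /\ linked (fun x => ~ K' x) p k.
Proof.
move=> H Hc D Kz; have [l [Hl E]] := gens_gen (inv p ** z).
have {}E : z = p ** gprod l by rewrite -E gmul_assoc mulgV gmul_1l.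
elim: l p E Hl => [|t l IH] p; first by rewrite mulg1 => <- _ []; exact: Hc.
rewrite /= gmul_assoc => E Hl Np.
case: (classic (K p)) => Kp; first by exists p; split=> //; exact: rt_refl.
have Ht : In t gens by apply: Hl; left.
have Kp' : ~ K' p by move=> /Hc.
have Kt' : ~ K' (p ** t) \/ K (p ** t).
  case: (classic (K (p ** t))) => Kt; [by right|left => /Hc Et].
  by apply: Np; rewrite (H p t).
case: (classic (K (p ** t))) => Kt.
  exists (p ** t); split=> //; apply: rt_step; exists t; split=> //; split=> //.
  by split=> // /D.
have Hl' : gen_word l by move=> u Hu; apply: Hl; right.
have [|k [Kk Lk]] := IH (p ** t) E Hl'; first by rewrite -(H p t).
exists k; split=> //; apply: rt_trans Lk; apply: rt_step; exists t.
by case: Kt'.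
Qed.

(* Two translates of the boundary region that both separate the same three
   points must meet: if they were disjoint, the second region would lie on one
   side of the first one, and the two other sides would be joined outside it. *)
Lemma three_points_meet {T : Type} (K : G -> Prop) (chi : G -> T) k0 g g' p q r :
  clean K chi -> connected K -> K k0 ->
  chi (g ** p) <> chi (g ** q) -> chi (g ** q) <> chi (g ** r) ->
  chi (g ** p) <> chi (g ** r) ->
  chi (g' ** p) <> chi (g' ** q) -> chi (g' ** q) <> chi (g' ** r) ->
  chi (g' ** p) <> chi (g' ** r) ->
  exists x, K (g ** x) /\ K (g' ** x).
Proof.
move=> H C K0 N1 N2 N3 N1' N2' N3'; apply: NNPP => D.
have {}D x : K (g' ** x) -> ~ K (g ** x) by move=> ? ?; apply: D; exists x.
have Cg := clean_translate K chi g H; have Cg' := clean_translate K chi g' H.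
have z : exists z, K (g' ** z).
  by exists (inv g' ** k0); rewrite gmul_assoc mulgV gmul_1l.
case: z => z Kz.
have Hc x : K (g' ** x) -> chi (g ** x) = chi (g ** z).
  move=> Kx; apply: (clean_linked _ _ _ _ Cg); apply: linked_sub D _.
  exact: (connected_translate K g' C).
have joined a b : chi (g ** a) <> chi (g ** z) -> chi (g ** b) <> chi (g ** z) ->
    chi (g' ** a) = chi (g' ** b).
  move=> Na Nb.
  have [k [Kk La]] := reach_boundary _ _ _ _ _ _ Cg Hc D Kz Na.
  have [k' [Kk' Lb]] := reach_boundary _ _ _ _ _ _ Cg Hc D Kz Nb.
  apply: (clean_linked _ _ _ _ Cg'); apply: rt_trans La _.
  apply: rt_trans (linked_sym _ _ _ Lb).
  apply: (linked_sub (fun x => K (g ** x))); first by move=> x Kx /D.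
  exact: (connected_translate K g C).
case: (classic (chi (g ** p) = chi (g ** z))) => Ep.
  by apply: N2'; apply: joined; congruence.
case: (classic (chi (g ** q) = chi (g ** z))) => Eq.
  by apply: N3'; apply: joined; congruence.
by apply: N1'; apply: joined.
Qed.

(** Take the union of finitely many paths from the identity to the points of [L]. *)
Lemma connected_hull (L : list G) :
  exists K, incl L K /\ In one K /\ connected (fun x => In x K).
Proof.
have path l : gen_word l -> forall x, exists K, In x K /\ In (x ** gprod l) K /\
    forall y, In y K -> linked (fun z => In z K) x y.
  elim: l => [|t l IH] Hl x.
    exists [x]; rewrite mulg1; do !split; try by left.
    by move=> y [<-|[]]; exact: rt_refl.
  have [|K [H1 [H2 H3]]] := IH _ (x ** t); first by move=> u Hu; apply: Hl; right.
  exists (x :: K); split; first by left.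
  rewrite /= gmul_assoc; split; first by right.
  move=> y [<-|/H3 Hy]; first exact: rt_refl.
  apply: rt_trans; last by apply: linked_sub Hy => z; right.
  apply: rt_step; exists t; do !split; [by apply: Hl; left|by left|by right].
suff [K [S [K1 H]]] : exists K, incl L K /\ In one K /\
    forall y, In y K -> linked (fun z => In z K) one y.
  exists K; split=> //; split=> // a b Ka Kb; apply: rt_trans (H _ Kb).
  exact/linked_sym/H.
elim: L => [|g L [K [S [K1 H]]]].
  exists [one]; do !split; [by []|by left|by move=> y [<-|[]]; exact: rt_refl].
have [l [Hl ->]] := gens_gen g; have [K' [K'1 [K'g H']]] := path l Hl one.
rewrite gmul_1l in K'g; exists (K ++ K'); split.
  by move=> y [<-|/S Hy]; apply: in_or_app; [right|left].
split; first by apply: in_or_app; left.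
by move=> y /in_app_iff[/H|/H']; apply: linked_sub => z Hz; apply: in_or_app; [left|right].
Qed.

(** * The quasimorphism of a colouring with finite connected boundary *)

Section ColouringQuasimorphism.
Context {T : Type}.
Variables (chi : G -> T) (omega : T -> T -> R).

Definition colour_sum (h : G) : R := fsum (fun g => omega (chi g) (chi (g ** h))).

Variable K : list G.
Hypothesis chi_clean : clean (fun x => In x K) chi.
Hypothesis omega_anti : forall i j, omega i j = - omega j i.
Hypothesis omega_le1 : forall i j, Rabs (omega i j) <= 1.

Lemma omega_diag i : omega i i = 0.
Proof. by have := omega_anti i i; lra. Qed.

Lemma colour_supp h : exists l, supp_in (fun g => omega (chi g) (chi (g ** h))) l.
Proof.
have [l [Hl ->]] := gens_gen h.
exists (flat_map (fun s => map (fun k => k ** inv (gprod s)) K) (prefixes l)) => g N.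
have [|s [Hs Ks]] := clean_cross _ _ g _ chi_clean Hl.
  by move=> E; apply: N; rewrite -E omega_diag.
apply/in_flat_map; exists s; split=> //; apply/in_map_iff.
by exists (g ** gprod s); rewrite mulgK.
Qed.

(** After the shift of [g] by [x] in the sum for [y], the defect is the sum of [th]. By antisymmetry
    [th g] vanishes unless the points [1], [x], [xy], translated by [g], have three different
    colours. All such [g] come from boundary regions meeting that of one fixed [g0], so at most the
    square of the length of [K] of them occur, each contributing at most 3. *)
Lemma colour_sum_defect x y : connected (fun x => In x K) -> K <> [] ->
  Rabs (delta1 G colour_sum x y) <= 3 * INR (length K * length K).
Proof.
move=> C K0.
pose th g := omega (chi g) (chi (g ** x)) + (omega (chi (g ** x)) (chi (g ** x ** y))
  + -1 * omega (chi g) (chi (g ** (x ** y)))).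
have [lx Sx] := colour_supp x; have [ly Sy] := colour_supp y.
have [lz Sz] := colour_supp (x ** y).
have Sy' := supp_shift _ x _ Sy.
have Sz' : supp_in (fun g => -1 * omega (chi g) (chi (g ** (x ** y)))) lz.
  by move=> g Hg; apply: Sz => E; apply: Hg; rewrite E; lra.
have -> : delta1 G colour_sum x y = fsum th.
  rewrite /th (fsum_add _ _ lx (map (fun g => g ** inv x) ly ++ lz)) //; last first.
    move=> g Hg; apply: in_or_app.
    case: (Req_dec (omega (chi (g ** x)) (chi (g ** x ** y))) 0) => E.
      by right; apply: Sz' => E'; apply: Hg; rewrite E E'; lra.
    by left; apply: Sy'.
  rewrite (fsum_add _ _ _ _ Sy' Sz') (fsum_scale _ _ _ Sz).
  rewrite (fsum_shift (fun g => omega (chi g) (chi (g ** y))) x _ Sy).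
  by rewrite /delta1 /colour_sum; lra.
have th3 g : Rabs (th g) <= 3.
  rewrite /th; have := omega_le1 (chi g) (chi (g ** x)).
  have := omega_le1 (chi (g ** x)) (chi (g ** x ** y)).
  have := omega_le1 (chi g) (chi (g ** (x ** y))).
  by rewrite /Rabs; do 4 case: Rcase_abs; lra.
have sep g : th g <> 0 -> chi (g ** one) <> chi (g ** x) /\
    chi (g ** x) <> chi (g ** (x ** y)) /\ chi (g ** one) <> chi (g ** (x ** y)).
  rewrite /th mulg1 gmul_assoc => N; split; [|split] => E; apply: N; rewrite E.
  - by rewrite omega_diag; lra.
  - by rewrite omega_diag; lra.
  - by rewrite omega_diag (omega_anti (chi (g ** x ** y))); lra.
case: (classic (exists g0, th g0 <> 0)) => [[g0 /sep [a1 [a2 a3]]]|N]; last first.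
  rewrite fsum_eq0; last by move=> g; apply: NNPP => ?; apply: N; exists g.
  by rewrite Rabs_R0; have := pos_INR (length K * length K); lra.
rewrite -length_prod.
(* If [g0 z = k] and [g z = k'] are both in [K], then [g = k' k^-1 g0]. *)
pose l := map (fun p => snd p ** inv (fst p) ** g0) (list_prod K K).
rewrite -(length_map (fun p => snd p ** inv (fst p) ** g0)).
apply: fsum_bound => //; first lra.
move=> g /sep [b1 [b2 b3]].
have [k0 Kk0] : exists k, In k K by case: (K) K0 => // k ? _; exists k; left.
have [z [H1 H2]] := three_points_meet _ _ k0 g0 g _ _ _ chi_clean C Kk0 a1 a2 a3 b1 b2 b3.
apply/in_map_iff; exists (g0 ** z, g ** z); split; last exact: in_prod.
by rewrite /=; gsimp.
Qed.

End ColouringQuasimorphism.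
End Cayley.

(** * From ends to a ping-pong pair *)

Definition sym_gens {G : Group} (S : list G) : list G := S ++ map (ginv G) S.

Lemma sym_gens_inv {G : Group} (S : list G) t : In t (sym_gens S) -> In (inv t) (sym_gens S).
Proof.
move=> /in_app_iff[H|/in_map_iff[s [<- H]]]; apply: in_or_app.
  by right; apply: in_map.
by left; rewrite invgK.
Qed.

Lemma sym_gens_gen {G : Group} (S : list G) : generates G S ->
  forall g : G, exists l, gen_word (sym_gens S) l /\ g = gprod l.
Proof.
move=> H g; have [w [Hw ->]] := H g.
elim: w Hw => [|[e s] w IH] Hw; first by exists []; split=> // t [].
have [|l [Hl E]] := IH; first by move=> p Hp; apply: Hw; right.
have Hs : In s S by apply: (Hw (e, s)); left.
exists ((match e with true => s | false => inv s end) :: l); split.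
  move=> t [<-|/Hl //]; apply: in_or_app.
  by case: e {Hw}; [left|right; apply: in_map].
by rewrite /= E; case: (e).
Qed.

Lemma cayley_adj_sym_gens {G : Group} (S : list G) x t :
  In t (sym_gens S) -> cayley_adj G S x (x ** t).
Proof.
move=> /in_app_iff[H|/in_map_iff[s [<- H]]]; first by exists t; split=> //; left.
by exists s; split=> //; right; rewrite mulgVK.
Qed.

Lemma conn_outside_sym {G : Group} (S K : list G) a b :
  conn_outside G S K a b -> conn_outside G S K b a.
Proof.
elim=> {a b} [a b [[s [Hs E]] [Pa Pb]]|a|a b c _ H1 _ H2].
- apply: rt_step; do !split=> //; exists s; split=> //; tauto.
- exact: rt_refl.
- exact: rt_trans H2 H1.
Qed.

Definition dec (P : Prop) : bool :=
  match excluded_middle_informative P with left _ => true | right _ => false end.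

Lemma decP (P : Prop) : dec P = true <-> P.
Proof. by rewrite /dec; case: excluded_middle_informative. Qed.

(** Three infinite components are separated by some [K0], and [K] is a connected finite hull of it
    with colour 0. Colours 1 and 2 are the first two components of the complement of [K0], minus
    [K]; colour 3 is all the rest and contains the third component minus [K]. *)
Lemma ends_colouring {G : Group} (S : list G) :
  generates G S -> infinitely_many_ends G S ->
  exists (K : list G) (chi : G -> nat),
    In one K /\ connected (sym_gens S) (fun x => In x K) /\
    clean (sym_gens S) (fun x => In x K) chi /\
    (forall x, In x K -> chi x = 0%nat) /\
    (forall x, ~ In x K -> (1 <= chi x <= 3)%nat) /\
    (forall i, (1 <= i <= 3)%nat -> forall L : list G, exists x, chi x = i /\ ~ In x L).
Proof.
move=> HS HE; have [K0 [f [Hinf Hsep]]] := HE 3%nat.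
have [K [S0 [K1 C]]] := connected_hull _ (sym_gens_gen S HS) (sym_gens_inv S) K0.
pose co := conn_outside G S K0.
pose chi x := if dec (In x K) then 0%nat else
  if dec (co (f 0%nat) x) then 1%nat else if dec (co (f 1%nat) x) then 2%nat else 3%nat.
exists K, chi; split=> //; split=> //; split.
  move=> x t Ht Kx Kt; rewrite /chi.
  have E i : dec (co (f i) x) = dec (co (f i) (x ** t)).
    have St a b : cayley_adj G S a b -> ~ In a K -> ~ In b K -> co (f i) a -> co (f i) b.
      move=> A Ka Kb Ca; apply: rt_trans Ca _; apply: rt_step; do !split=> //.
        by move=> /S0.
      by move=> /S0.
    have A := cayley_adj_sym_gens S x t Ht.
    have A' := cayley_adj_sym_gens S (x ** t) (inv t) (sym_gens_inv S t Ht).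
    rewrite mulgK in A'; rewrite /dec.
    case: excluded_middle_informative => H1; case: excluded_middle_informative => H2 //.
      by case: H2; apply: St A _ _ H1.
    by case: H1; apply: St A' _ _ H2.
  rewrite !E; have -> : dec (In x K) = false by rewrite /dec; case: excluded_middle_informative.
  by have -> : dec (In (x ** t) K) = false by rewrite /dec; case: excluded_middle_informative.
split.
  by move=> x /decP; rewrite /chi => ->.
split.
  move=> x Kx; rewrite /chi; have -> : dec (In x K) = false.
    by rewrite /dec; case: excluded_middle_informative.
  by case: dec; [|case: dec]; lia.
move=> i Hi L.
have [x [Hx [Kx Lx]]] : exists x, co (f (i - 1)%nat) x /\ ~ In x K /\ ~ In x L.
  have [|_ N] := Hinf (i - 1)%nat; first by lia.
  apply: NNPP => N'; apply: N; exists (K ++ L) => h Hh.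
  apply: NNPP => N; apply: N'; exists h; split=> //.
  by split=> H; apply: N; apply: in_or_app; [left|right].
have sep a b : (a < b < 3)%nat -> co (f b) x -> ~ co (f a) x.
  move=> Hab Hb Ha; case: (Hsep a b ltac:(lia) ltac:(lia)).
  by apply: rt_trans Ha _; apply: conn_outside_sym.
exists x; split=> //; rewrite /chi /dec.
case: (excluded_middle_informative (In x K)) => // _.
case: (excluded_middle_informative (co (f 0%nat) x)) => H0;
  case: (excluded_middle_informative (co (f 1%nat) x)) => H1;
  case: i Hi Hx => [|[|[|[|i]]]] //= Hi Hx; try lia;
  solve [by case: (sep 0 1)%nat => //; lia | by case: (sep 0 2)%nat => //; lia
    | by case: (sep 1 2)%nat => //; lia].
Qed.

Section PingPong.
Context {G : Group}.
Variables (gens : list G) (K : list G) (chi : G -> nat).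
Hypothesis gens_gen : forall g : G, exists l, gen_word gens l /\ g = gprod l.
Hypothesis K1 : In one K.
Hypothesis K_conn : connected gens (fun x => In x K).
Hypothesis chi_clean : clean gens (fun x => In x K) chi.
Hypothesis chi_out : forall x, ~ In x K -> (1 <= chi x <= 3)%nat.
Hypothesis chi_inf : forall i, (1 <= i <= 3)%nat -> forall L : list G,
  exists x, chi x = i /\ ~ In x L.

Definition sends (g : G) (i j : nat) : Prop := forall x, chi x <> j -> chi (g ** x) = i.

Lemma sends_inv g i j : sends g i j -> sends (inv g) j i.
Proof.
move=> H x Nx; apply: NNPP => /H; rewrite gmul_assoc mulgV gmul_1l; exact: Nx.
Qed.

Lemma sends_mul g h i j i' j' : sends g i j -> sends h i' j' -> i' <> j -> sends (g ** h) i j'.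
Proof. by move=> Hg Hh N x /Hh E; rewrite -gmul_assoc; apply: Hg; rewrite E. Qed.

(** Choose [g] of colour [i] so far out that [gK] misses [K]. Being connected, [gK] has the single
    colour [i], so every point of another colour reaches [K] outside [gK]. Hence [inv g] moves all
    these points into one colour, that of [inv g]; passing to inverses gives the claim. *)
Lemma sends_exists i : (1 <= i <= 3)%nat -> exists g j, (1 <= j <= 3)%nat /\ sends g i j.
Proof.
move=> Hi.
have [g [Eg Ng]] := chi_inf i Hi (map (fun p => fst p ** inv (snd p)) (list_prod K K)).
have D x : In (inv g ** x) K -> ~ In x K.
  move=> H1 H2; apply: Ng; apply/in_map_iff; exists (x, inv g ** x).
  by split; [rewrite /=; gsimp|exact: in_prod].
have Kg : In (inv g ** g) K by rewrite gmul_Vl.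
have Hc x : In (inv g ** x) K -> chi x = i.
  move=> Hx; rewrite -Eg; apply: (clean_linked _ _ _ _ _ chi_clean).
  apply: linked_sub D _; exact: (connected_translate _ _ _ K_conn).
have key x : chi x <> i -> chi (inv g ** x) = chi (inv g).
  move=> Nx.
  have [k [Kk L]] := reach_boundary _ gens_gen _ _ _ _ _ _ chi_clean Hc D Kg Nx.
  rewrite -{2}(mulg1 (inv g)).
  apply: (clean_linked gens (fun y => In (inv g ** y) K) (fun y => chi (inv g ** y))).
    exact: (clean_translate _ _ _ (inv g) chi_clean).
  apply: rt_trans L _; apply: (linked_sub _ (fun y => In y K)); last exact: K_conn.
  by move=> y Ky /D.
exists g, (chi (inv g)); split.
  by apply: chi_out => H; case: (D one); rewrite ?mulg1.
by rewrite -{1}(invgK g); apply: sends_inv => x; exact: key.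
Qed.

(** The colours given by [sends_exists] may coincide, but an element sending 1 to 1 times one
    sending 2 to 2 has distinct colours. With [q] attracting to the third colour [k], the elements
    [p p] and [p q p] move [U] to disjoint sets: after cancelling [p] the images lie in the colours
    [i] and [k]. *)
Lemma ping_pong_pair : exists (i j : nat) (a b c d : G),
  i <> j /\ (1 <= i <= 3)%nat /\ (1 <= j <= 3)%nat /\
  sends a i j /\ sends b i j /\ a = c ** d /\ b = d ** c /\
  forall x y, chi x = i -> chi y = i -> a ** x <> b ** y.
Proof.
have [p0 [i0 [j0 [Hi0 [Hj0 [Nij0 Hp0]]]]]] : exists p i j, (1 <= i <= 3)%nat /\ (1 <= j <= 3)%nat /\
    i <> j /\ sends p i j.
  have [g [l [Hl Hg]]] := sends_exists 1 ltac:(lia).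
  have [h [m [Hm Hh]]] := sends_exists 2 ltac:(lia).
  case: (classic (l = 1%nat)) => El; last by exists g, 1%nat, l; do !split=> //; lia.
  case: (classic (m = 2%nat)) => Em; last by exists h, 2%nat, m; do !split=> //; lia.
  exists (g ** h), 1%nat, 2%nat; do !split; try lia; subst l m.
  exact: (sends_mul _ _ _ _ _ _ Hg Hh).
have [k [Hk [Nki0 Nkj0]]] : exists k, (1 <= k <= 3)%nat /\ k <> i0 /\ k <> j0.
  case: (classic (i0 = 1 \/ j0 = 1)%nat) => E1; last by exists 1%nat; lia.
  by case: (classic (i0 = 2 \/ j0 = 2)%nat) => E2; [exists 3%nat|exists 2%nat]; lia.
have [q [l [Hl Hq]]] := sends_exists k Hk.
have [p [i [j [Hi [Hj [Nij [Hp [Nki [Nkj Nli]]]]]]]]] :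
    exists p i j, (1 <= i <= 3)%nat /\ (1 <= j <= 3)%nat /\ i <> j /\ sends p i j /\
      k <> i /\ k <> j /\ l <> i.
  case: (classic (l = i0)) => E; last by exists p0, i0, j0.
  (* Inverting [p0] exchanges its two colours, so the attracting one is no longer the colour [l]
     that [q] repels. *)
  exists (inv p0), j0, i0; do !split=> //; try lia; exact: sends_inv.
pose a := p ** p; pose b := p ** q ** p.
have Ha : sends a i j by apply: (sends_mul _ _ _ _ _ _ Hp Hp).
have Hpq : sends (p ** q) i l by apply: (sends_mul _ _ _ _ _ _ Hp Hq).
have Hb : sends b i j by apply: (sends_mul _ _ _ _ _ _ Hpq Hp); congruence.
have dis x y : chi x = i -> chi y = i -> a ** x <> b ** y.
  rewrite /a /b => Hx Hy; rewrite -!gmul_assoc => /mulg_lcancel E.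
  have := f_equal chi E; rewrite (Hp x) ?(Hq (p ** y)) ?(Hp y); congruence.
(* Passing to [a b] and [b a] makes the pair conjugate, so homomorphisms to the reals agree on it,
   and keeps the ping-pong conditions. *)
clearbody a b; exists i, j, (a ** b), (b ** a), a, b; do !split=> //.
- exact: (sends_mul _ _ _ _ _ _ Ha Hb).
- exact: (sends_mul _ _ _ _ _ _ Hb Ha).
move=> x y Hx Hy; rewrite -!gmul_assoc; apply: dis; [apply: Hb|apply: Ha]; congruence.
Qed.

End PingPong.

(** * Words *)

Lemma app_split {A : Type} (x y x' y' : list A) :
  x ++ y = x' ++ y' -> (length x <= length x')%nat -> exists l, x' = x ++ l /\ y = l ++ y'.
Proof.
elim: x x' => [|c x IH] x' /=; first by move=> -> _; exists x'.
case: x' => [|c' x'] /=; first by lia.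
case=> <- E H; have [|l [-> ->]] := IH x' E; [lia|by exists l].
Qed.

Lemma length_flat_map_le {A B : Type} (f : A -> list B) (l : list A) n :
  (forall x, In x l -> (length (f x) <= n)%nat) -> (length (flat_map f l) <= length l * n)%nat.
Proof.
elim: l => //= x l IH H; rewrite length_app.
by have := H x (or_introl eq_refl); have := IH (fun y Hy => H y (or_intror Hy)); lia.
Qed.

Fixpoint tails {A : Type} (l : list A) : list (list A) :=
  l :: match l with [] => [] | _ :: l' => tails l' end.

Lemma length_tails {A : Type} (l : list A) : length (tails l) = S (length l).
Proof. by elim: l => //= x l ->. Qed.

Lemma tails_length_le {A : Type} (l m : list A) : In m (tails l) -> (length m <= length l)%nat.
Proof.
elim: l => [|x l IH] /=; first by case=> [<-|[]].
by case=> [<- //|/IH]; lia.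
Qed.

Lemma in_tails_app {A : Type} (p l : list A) : In l (tails (p ++ l)).
Proof. by elim: p => [|x p IH]; [case: l => [|? ?]; left|right]. Qed.

Lemma in_prefixes_app {A : Type} (l r : list A) : In l (prefixes (l ++ r)).
Proof.
elim: l => [|x l IH]; first by case: r; left.
by right; apply: in_map.
Qed.

Definition factors {A : Type} (l : list A) : list (list A) := flat_map prefixes (tails l).

Lemma in_factors {A : Type} (p z r : list A) : In z (factors (p ++ z ++ r)).
Proof.
apply/in_flat_map; exists (z ++ r); split; [exact: in_tails_app|exact: in_prefixes_app].
Qed.

Lemma length_factors {A : Type} (l : list A) :
  (length (factors l) <= S (length l) * S (length l))%nat.
Proof.
rewrite -{1}(length_tails l); apply: length_flat_map_le => m /tails_length_le.
by rewrite length_prefixes; lia.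
Qed.

Definition pow {A : Type} (u : list A) (k : nat) : list A := concat (repeat u k).

Lemma pow_add {A : Type} (u : list A) i j : pow u (i + j) = pow u i ++ pow u j.
Proof. by rewrite /pow repeat_app concat_app. Qed.

Lemma pow_1 {A : Type} (u : list A) : pow u 1 = u.
Proof. exact: app_nil_r. Qed.

Lemma length_pow {A : Type} (u : list A) k : length (pow u k) = (k * length u)%nat.
Proof. by elim: k => //= k IH; rewrite /pow /= length_app -/(pow u k) IH. Qed.

Lemma pow_cut {A : Type} (u : list A) k p q : pow u k = p ++ q -> k <> 0%nat ->
  exists j i t t', p = pow u j ++ t /\ t ++ t' = u /\ q = t' ++ pow u i.
Proof.
elim: k p => // k IH p.
rewrite /pow /= -/(pow u k) => E _.
case: (Nat.le_gt_cases (length p) (length u)) => L.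
  have [t' [E1 E2]] := app_split _ _ _ _ (eq_sym E) L.
  by exists 0%nat, k, p, t'; rewrite -E1.
have [p' [E1 E2]] := app_split _ _ _ _ E (Nat.lt_le_incl _ _ L).
case: k IH {E} E2 => [|k] IH E2.
  have [Ep Eq] : p' = [] /\ q = [] by apply: app_eq_nil.
  by exists 0%nat, 0%nat, u, []; rewrite E1 Ep Eq !app_nil_r.
have [|j [i [t [t' [E3 [E4 E5]]]]]] := IH _ E2; first by [].
exists (S j), i, t, t'; split=> //.
by rewrite E1 E3 /pow /= app_assoc.
Qed.

(** By periodicity the factor can be moved so as to start in the first copy of [u], and then [L]
    further copies contain it. So a fixed power of [u] sees all short factors of all powers. *)
Lemma factor_pow {A : Type} (u : list A) k L p z r : pow u k = p ++ z ++ r -> u <> [] ->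
  (length z <= L)%nat -> In z (factors (pow u (S L))).
Proof.
move=> E Hu Lz; case: k E => [|k] E.
  have [_ /app_eq_nil[-> _]] : p = [] /\ z ++ r = [] by apply: app_eq_nil.
  exact: (in_factors [] []).
have [//|j [i [t [t' [_ [E1 E2]]]]]] := pow_cut _ _ _ _ E.
have {}E2 : (t ++ z) ++ r = pow u (S i).
  by rewrite -app_assoc E2 app_assoc E1.
have Lt : (length (t ++ z) <= length (pow u (S L)))%nat.
  rewrite length_pow -E1 !length_app.
  have : (1 <= length (t ++ t'))%nat by rewrite E1; case: (u) Hu => //= *; lia.
  rewrite length_app; nia.
suff [r' Er] : exists r', pow u (S L) = (t ++ z) ++ r'.
  by rewrite Er -app_assoc; exact: in_factors.
case: (Nat.le_gt_cases L i) => H.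
  have E3 : (t ++ z) ++ r = pow u (S L) ++ pow u (i - L).
    by rewrite E2 -pow_add; congr pow; lia.
  by have [l [El _]] := app_split _ _ _ _ E3 Lt; exists l.
exists (r ++ pow u (L - i)); rewrite app_assoc E2 -pow_add; congr pow; lia.
Qed.

(* A cut of [(v w c^M)^k] lying in the second half of [v w], or just after it, is
   followed by letters of [w c^M] only; any other cut is preceded by letters of
   [c^M v] only. *)
Lemma cut_factor {A : Type} (v w : list A) c h L k p z' z r :
  length v = h -> length w = h ->
  pow (v ++ w ++ repeat c (L + L)) k = p ++ z' ++ z ++ r ->
  (length z <= L)%nat -> (length z' <= L)%nat ->
  In z (factors (w ++ repeat c (L + L))) \/ In z' (factors (repeat c (L + L) ++ v)).
Proof.
move=> Lv Lw; rewrite app_assoc (app_assoc p); set u := _ ++ repeat c _ => E Lz Lz'.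
case: k E => [|k] E.
  left; have [_ /app_eq_nil[-> _]] : p ++ z' = [] /\ z ++ r = [] by apply: app_eq_nil.
  exact: (in_factors [] []).
have [//|j [i [t [t' [E1 [E2 E3]]]]]] := pow_cut _ _ _ _ E.
have Lu : length u = (h + h + (L + L))%nat by rewrite /u !length_app repeat_length; lia.
have Lt : (length t + length t' = h + h + (L + L))%nat by rewrite -Lu -E2 length_app.
case: (Nat.le_gt_cases h (length t)) => Ht; last first.
  right.
  have [l [El _]] : exists l, v = t ++ l /\ t' = l ++ (w ++ repeat c (L + L)).
    by apply: app_split; [rewrite E2 /u app_assoc|lia].
  rewrite El app_assoc.
  case: j E1 => [|j] E1; last first.
    rewrite -(Nat.add_1_r j) pow_add pow_1 {1}/u -!app_assoc in E1.
    rewrite !app_assoc in E1; rewrite -(app_assoc _ (repeat c _)) in E1.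
    have [|l' [_ ->]] := app_split _ _ _ _ (eq_sym E1).
      have := f_equal (@length A) E1; rewrite !length_app repeat_length; lia.
    by rewrite -app_assoc; exact: in_factors.
  rewrite -/([] ++ t) in E1; rewrite /= in E1; rewrite -E1 -!app_assoc app_assoc.
  exact: in_factors.
(* If at most [L] letters of the run precede the cut, at least [L] letters follow in this copy and
   hold [z]; otherwise more than [L] letters of the run precede the cut and hold [z']. *)
case: (Nat.le_gt_cases (length t) (h + h + L)) => Ht'.
  left.
  have [r' [Er _]] := app_split _ _ _ _ E3 ltac:(lia).
  have [l [_ ->]] : exists l, t = v ++ l /\ w ++ repeat c (L + L) = l ++ t'.
    by apply: app_split; [rewrite E2 /u app_assoc|lia].
  by rewrite Er; exact: in_factors.
right.
have [l [El ->]] : exists l, t = (v ++ w) ++ l /\ repeat c (L + L) = l ++ t'.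
  by apply: app_split; [rewrite E2|rewrite length_app; lia].
rewrite El app_assoc in E1.
have Ll : (length l > L)%nat by have := f_equal (@length A) El; rewrite !length_app; lia.
have [|l' [_ ->]] := app_split _ _ _ _ (eq_sym E1).
  have := f_equal (@length A) E1; rewrite !length_app; lia.
by rewrite -!app_assoc; exact: in_factors.
Qed.

Fixpoint words (h : nat) : list (list bool) :=
  match h with
  | 0%nat => [[]]
  | S h' => map (cons true) (words h') ++ map (cons false) (words h')
  end.

Lemma length_words h : length (words h) = (2 ^ h)%nat.
Proof. by elim: h => //= h IH; rewrite length_app !length_map IH; lia. Qed.

Lemma in_words h w : In w (words h) -> length w = h.
Proof.
elim: h w => [|h IH] w /=; first by case=> [<-|[]].
by move=> /in_app_iff[] /in_map_iff[v [<- /IH /= ->]].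
Qed.

Lemma NoDup_words h : NoDup (words h).
Proof.
elim: h => [|h IH] /=; first by apply: NoDup_cons => //; exact: NoDup_nil.
apply: NoDup_app.
- by apply: NoDup_map_NoDup_ForallPairs IH => x y _ _ [].
- by apply: NoDup_map_NoDup_ForallPairs IH => x y _ _ [].
by move=> w /in_map_iff[v [<- _]] /in_map_iff[v' []].
Qed.

Lemma NoDup_list_prod {A B : Type} (l : list A) (m : list B) :
  NoDup l -> NoDup m -> NoDup (list_prod l m).
Proof.
move=> Nl Nm; elim: Nl => [|x l' Hx _ IH] /=; first exact: NoDup_nil.
apply: NoDup_app => //.
  by apply: NoDup_map_NoDup_ForallPairs Nm => y z _ _ [].
by move=> _ /in_map_iff[y [<- _]] /in_prod_iff[].
Qed.

Lemma quadratic_lt_exp A n0 : exists h, (n0 <= h)%nat /\ (A * (S h * S h) < 2 ^ h)%nat.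
Proof.
(* With [h = 4m], [2^h] is at least [(m+1)^4]; one factor [(m+1)^2] exceeds [16A] and 16 times the
   other bounds [(h+1)^2]. *)
pose m := (16 * A + n0)%nat; exists (4 * m)%nat; split; first by rewrite /m; lia.
rewrite (Nat.mul_comm 4 m) Nat.pow_mul_r.
have H : (m + 1 <= 2 ^ m)%nat by have := Nat.pow_gt_lin_r 2 m ltac:(lia); lia.
have : ((m + 1) ^ 4 <= (2 ^ m) ^ 4)%nat by apply: Nat.pow_le_mono_l.
have -> : ((m + 1) ^ 4 = (m + 1) * (m + 1) * ((m + 1) * (m + 1)))%nat by rewrite /=; ring.
have : (16 * A < (m + 1) * (m + 1))%nat by rewrite /m; nia.
have : (S (m * 4) * S (m * 4) <= 16 * ((m + 1) * (m + 1)))%nat by nia.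
move: (S (m * 4) * S (m * 4))%nat ((m + 1) * (m + 1))%nat => x y; nia.
Qed.

(** * Counting quasimorphisms *)

(** Only the colours 1 and 2 count: the associated [colour_sum] is the number of passages from 1 to
    2 minus the number from 2 to 1. *)
Definition omega12 (i j : nat) : R :=
  match i, j with 1%nat, 2%nat => 1 | 2%nat, 1%nat => -1 | _, _ => 0 end.

Section Words.
Context {G : Group}.
Variables (gens : list G) (K : list G) (U V : G -> Prop) (a b : G).
Hypothesis gens_gen : forall g : G, exists l, gen_word gens l /\ g = gprod l.
Hypothesis gens_inv : forall t, In t gens -> In (inv t) gens.
Hypothesis U_clean : clean gens (fun x => In x K) U.
Hypothesis V_clean : clean gens (fun x => In x K) V.
Hypothesis UV : forall x, U x -> ~ V x.
Hypothesis U1 : ~ U one.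
Hypothesis V1 : ~ V one.
Hypothesis a_push : forall x, ~ V x -> U (a ** x).
Hypothesis b_push : forall x, ~ V x -> U (b ** x).
Hypothesis ab_disjoint : forall x y, U x -> U y -> a ** x <> b ** y.

Definition letter (c : bool) : G := match c with true => a | false => b end.
Definition ev (w : list bool) : G := gprod (map letter w).

Lemma ev_cons c w : ev (c :: w) = letter c ** ev w.
Proof. by []. Qed.

Lemma ev_app v w : ev (v ++ w) = ev v ** ev w.
Proof. by rewrite /ev map_app gprod_app. Qed.

(** The last letter of [w] moves [x] into [U], which misses [V], so each earlier letter again maps
    into [U]. *)
Lemma ev_push w x : w <> [] -> ~ V x -> U (ev w ** x).
Proof.
have L c y : ~ V y -> U (letter c ** y) by case: c => /=; [exact: a_push|exact: b_push].
elim: w => // c w IH _ Vx; rewrite /ev /= -gmul_assoc; apply: L.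
case: (w) IH => [|d w'] IH; first by rewrite /= gmul_1l.
by apply: UV; apply: IH.
Qed.

Lemma ev_U w x : U x -> U (ev w ** x).
Proof.
case: w => [|c w] H; first by rewrite /ev /= gmul_1l.
by apply: ev_push => //; exact: UV.
Qed.

Lemma ev_inv_V w x : w <> [] -> ~ U x -> V (inv (ev w) ** x).
Proof.
by move=> Hw Ux; apply: NNPP => /(ev_push w _ Hw); rewrite gmul_assoc mulgV gmul_1l.
Qed.

Lemma ev_inv_U w x : ~ U x -> ~ U (inv (ev w) ** x).
Proof. by move=> Ux /(ev_U w); rewrite gmul_assoc mulgV gmul_1l. Qed.

Lemma ev_neq1 w : w <> [] -> ev w <> one.
Proof. by move=> Hw E; have := ev_push w one Hw V1; rewrite mulg1 E. Qed.

(** Apply both words to the point [a] of [U]: different first letters would put the common image in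
    both [aU] and [bU]. *)
Lemma ev_inj w w' : length w = length w' -> ev w = ev w' -> w = w'.
Proof.
have Ua : U a by rewrite -(mulg1 a); apply: a_push.
elim: w w' => [|c w IH] [|c' w'] //= [Hl] E.
suff Ec : c = c' by subst c'; rewrite !ev_cons in E; rewrite (IH _ Hl (mulg_lcancel _ _ _ E)).
have E' : letter c ** (ev w ** a) = letter c' ** (ev w' ** a).
  by rewrite !gmul_assoc -!ev_cons E.
case: c c' {E} E' => [] [] //= E'.
- by case: (ab_disjoint _ _ (ev_U w a Ua) (ev_U w' a Ua)).
- by case: (ab_disjoint _ _ (ev_U w' a Ua) (ev_U w a Ua)).
Qed.

Lemma NoDup_ev_prefixes w : NoDup (map ev (prefixes w)).
Proof.
elim: w => [|c w IH] /=; apply/NoDup_cons_iff.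
  by split=> //; exact: NoDup_nil.
split.
  by rewrite map_map => /in_map_iff[v [E _]]; case: (ev_neq1 (c :: v)).
rewrite map_map -(map_map ev (fun x => letter c ** x)).
by apply: NoDup_map_NoDup_ForallPairs IH => x y _ _; exact: mulg_lcancel.
Qed.

Lemma U_cross x l : gen_word gens l -> U x <> U (x ** gprod l) ->
  exists s, In s (prefixes l) /\ In (x ** gprod s) K.
Proof. exact: (clean_cross gens (fun x => In x K) U x l U_clean). Qed.

Lemma separated_length w x s : gen_word gens s ->
  (forall v v', w = v ++ v' -> U (inv (ev v) ** x) <> U (inv (ev v) ** x ** gprod s)) ->
  (length w < length K * S (length s))%nat.
Proof.
move=> Hs H; rewrite Nat.lt_nge => N.
pose f (p : list G * G) := x ** gprod (fst p) ** inv (snd p).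
have : (length (map ev (prefixes w)) <= length (map f (list_prod (prefixes s) K)))%nat.
  apply: NoDup_incl_length; first exact: NoDup_ev_prefixes.
  move=> _ /in_map_iff[v [<- Hv]].
  have [v' Ev] : exists v', w = v ++ v'.
    elim: (w) v Hv => [|c w' IH] v /=; first by case=> [<-|[]]; exists [].
    case=> [<-|/in_map_iff[v0 [<- /IH[v' ->]]]]; first by eexists.
    by exists v'.
  have [s' [Hs' Ks]] := U_cross _ s Hs (H v v' Ev).
  apply/in_map_iff; exists (s', inv (ev v) ** x ** gprod s'); split; last exact: in_prod.
  by rewrite /f /=; gsimp.
by rewrite !length_map length_prod !length_prefixes; nia.
Qed.

(* [fwd w x h]: the translate by [inv x] of the pattern (V, wU) has 1 on its V
   side and [h] on its wU side; [bwd w x h] has the two sides exchanged. *)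
Definition fwd (w : list bool) (x h : G) : Prop := V x /\ U (inv (ev w) ** x ** h).
Definition bwd (w : list bool) (x h : G) : Prop := U (inv (ev w) ** x) /\ V (x ** h).

Lemma fwd_prefix v w x h : fwd (v ++ w) x h -> fwd v x h.
Proof.
case=> Vx Ux; split=> //; have := ev_U w _ Ux; rewrite ev_app; by gsimp.
Qed.

Lemma bwd_prefix v w x h : bwd (v ++ w) x h -> bwd v x h.
Proof.
case=> Ux Vx; split=> //; have := ev_U w _ Ux; rewrite ev_app; by gsimp.
Qed.

Lemma fwd_length w x s : gen_word gens s -> fwd w x (gprod s) ->
  (length w < length K * S (length s))%nat.
Proof.
move=> Hs H; apply: (separated_length w x s Hs) => v v' E; rewrite {}E in H.
have [Vx Ux] := fwd_prefix _ _ _ _ H.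
have : ~ U (inv (ev v) ** x) by apply: ev_inv_U => /UV.
by move=> N E; apply: N; rewrite E.
Qed.

Lemma bwd_length w x s : gen_word gens s -> bwd w x (gprod s) ->
  (length w < length K * S (length s))%nat.
Proof.
move=> Hs H; apply: (separated_length w x s Hs) => v v' E; rewrite {}E in H.
have [Ux Vx] := bwd_prefix _ _ _ _ H.
have : ~ U (inv (ev v) ** x ** gprod s).
  by rewrite -gmul_assoc; apply: ev_inv_U => /UV.
by move=> N E; apply: N; rewrite -E.
Qed.

(** Positive words in [a], [b] are quasi-geodesic. Stripping the first letter [c] and the last
    letter of [z] leaves a word that occurs forward at [inv (letter c)], so [fwd_length] applies;
    the two stripped letters account for the [+ 1]. *)
Lemma word_length_le z s : gen_word gens s -> ev z = gprod s ->
  (length z <= length K * S (length s) + 1)%nat.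
Proof.
move=> Hs; case: z => [|c z]; first by move=> _ /=; lia.
have [->|[z' [d ->]]] : z = [] \/ exists z' d, z = z' ++ [d].
    by induction z as [|d z' _] using rev_ind; [left|right; exists z', d].
  by rewrite /=; lia.
move=> {z} E; move: z' E => z E.
suff /(fwd_length z _ s Hs) : fwd z (inv (letter c)) (gprod s).
  by rewrite /= length_app /=; lia.
have Ec : letter c = ev [c] by rewrite /ev /= mulg1.
split; first by rewrite Ec -(mulg1 (inv _)); apply: ev_inv_V.
rewrite -E (ev_app (c :: z) [d]) (ev_app [c] z) -Ec; gsimp.
have -> : letter d = ev [d] ** one by rewrite /ev /= !mulg1.
exact: ev_push.
Qed.

(** The first letter whose end point leaves [A] has a spelling in the generators that meets [K]. The
    end point is thus an element of [K] times a tail of one of two fixed spellings, so [F] depends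
    neither on [A] nor on the word. *)
Lemma cross_word : exists F : list G, forall A : G -> Prop,
  clean gens (fun x => In x K) A -> forall y x, A x -> ~ A (x ** ev y) ->
  exists y1 y2, y = y1 ++ y2 /\ ~ A (x ** ev y1) /\ In (x ** ev y1) F.
Proof.
have [sa [Hsa Ea]] := gens_gen a; have [sb [Hsb Eb]] := gens_gen b.
pose part s := map (fun p => snd p ** inv (gprod (fst p)) ** gprod s) (list_prod (prefixes s) K).
exists (part sa ++ part sb) => A HA; elim=> [|c y IH] x Ax; first by rewrite /ev /= mulg1.
rewrite /ev /= gmul_assoc => N.
case: (classic (A (x ** letter c))) => Ac.
  have [y1 [y2 [-> [N1 H1]]]] := IH _ Ac N.
  by exists (c :: y1), y2; rewrite /ev /= gmul_assoc.
exists [c], y; rewrite /ev /= mulg1; split=> //; split=> //.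
have main s : gen_word gens s -> letter c = gprod s -> In (x ** letter c) (part s).
  move=> Hs E; have [|s' [Hs' Ks]] := clean_cross _ _ _ x s HA Hs.
    by rewrite -E => E'; apply: Ac; rewrite -E'.
  apply/in_map_iff; exists (s', x ** gprod s'); split; last exact: in_prod.
  by rewrite E /=; gsimp.
by apply: in_or_app; case: c {N Ac} main => /= H; [left|right]; apply: H.
Qed.

(** * Occurrences of a pattern along a positive word *)

Section Matching.
Variable F : list G.
Hypothesis F_cross : forall A : G -> Prop,
  clean gens (fun x => In x K) A -> forall y x, A x -> ~ A (x ** ev y) ->
  exists y1 y2, y = y1 ++ y2 /\ ~ A (x ** ev y1) /\ In (x ** ev y1) F.

(** The path along [y] enters [U] and later [wU]. Both entrances happen at points of [F], up to the
    translation by [ev w] for the second, and [z] is the subword read between them. *)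
Lemma fwd_match w x y : fwd w x (ev y) -> exists p z r f f', y = p ++ z ++ r /\
  In f F /\ In f' F /\ ev w = f ** ev z ** inv f'.
Proof.
move=> [Vx Ux].
have cl : clean gens (fun x => In x K) (fun x => ~ U x).
  by move=> u t Ht Ku Kt; rewrite (U_clean u t).
have Nx : ~ U x by move=> /UV.
have Nwx : ~ U (inv (ev w) ** x) by exact: ev_inv_U.
have [y1 [r [Ey [N1 F1]]]] := F_cross _ cl _ _ Nwx (fun H => H Ux).
have Uy : ~ ~ U (x ** ev y1).
  move=> H; apply: N1 => /(ev_U w); rewrite !gmul_assoc mulgV gmul_1l; exact: H.
have [p [z [Ez [_ Fz]]]] := F_cross _ cl _ _ Nx Uy.
exists p, z, r, (x ** ev p), (inv (ev w) ** x ** ev y1).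
rewrite app_assoc -Ez; do !split=> //; by rewrite Ez ev_app; gsimp.
Qed.

(** The path leaves the nested sets [vwU], [vU] and [U] in this order, each time at a point of [F]
    up to translation. The subwords [z'] and [z] read in between match the inverses of [w] and [v]
    separately. *)
Lemma bwd_match v w x y : bwd (v ++ w) x (ev y) ->
  exists p z' z r f f' f'', y = p ++ z' ++ z ++ r /\ In f F /\ In f' F /\ In f'' F /\
  ev v = f ** inv (ev z) ** inv f' /\ ev w = f' ** inv (ev z') ** inv f''.
Proof.
move=> H; have [Uvx Vx] := bwd_prefix _ _ _ _ H; move: H => [Uwx _].
have Ux : U x by have := ev_U v _ Uvx; gsimp.
have [y0 [r [E0 [N0 F0]]]] := F_cross U U_clean _ _ Ux (fun H => UV _ H Vx).
have N0' : ~ U (inv (ev v) ** x ** ev y0) by rewrite -gmul_assoc; exact: ev_inv_U.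
have [y1 [z [E1 [N1 F1]]]] := F_cross U U_clean _ _ Uvx N0'.
have N1' : ~ U (inv (ev (v ++ w)) ** x ** ev y1).
  rewrite ev_app invMg -!gmul_assoc; apply: ev_inv_U; by rewrite gmul_assoc.
have [p [z' [E2 [_ F2]]]] := F_cross U U_clean _ _ Uwx N1'.
exists p, z', z, r, (x ** ev y0), (inv (ev v) ** x ** ev y1), (inv (ev (v ++ w)) ** x ** ev p).
split; first by rewrite E0 E1 E2 -!app_assoc.
do !split=> //; first by rewrite E1 ev_app; gsimp.
by rewrite E2 !ev_app; gsimp.
Qed.

(** Members of [F] and letters have generator length at most some [c], so [ev z] has length at most
    [c] times [length w + 2]; [word_length_le] turns this into a bound on [z]. *)
Lemma match_length : exists C, (1 <= C)%nat /\ forall w z f f', In f F -> In f' F ->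
  ev w = f ** ev z ** inv f' \/ ev w = f ** inv (ev z) ** inv f' ->
  (length z <= C * S (length w))%nat.
Proof.
pose short n g := exists l, gen_word gens l /\ g = gprod l /\ (length l <= n)%nat.
have short_mul n m g h : short n g -> short m h -> short (n + m)%nat (g ** h).
  move=> [l [Hl [-> Ll]]] [k [Hk [-> Lk]]]; exists (l ++ k).
  rewrite gprod_app length_app; split; last by split=> //; lia.
  by move=> t /in_app_iff[H|H]; [exact: (Hl t H)|exact: (Hk t H)].
have short_inv n g : short n g -> short n (inv g).
  move=> [l [Hl [-> Ll]]]; exists (map (ginv G) (rev l)).
  rewrite gprod_inv length_map length_rev; split; last by split.
  by move=> _ /in_map_iff[t [<- Ht]]; exact: (gens_inv _ (Hl t (proj2 (in_rev l t) Ht))).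
have [c Hc] : exists c, forall g, In g (a :: b :: F) -> short c g.
  elim: (a :: b :: F) => [|g L [c Hc]]; first by exists 0%nat.
  have [l [Hl E]] := gens_gen g.
  exists (c + length l)%nat => h [<-|/Hc[k [Hk [Ek Lk]]]]; [exists l|exists k]; do !split=> //; lia.
have short_ev w : short (length w * c)%nat (ev w).
  elim: w => [|d w IH]; first by exists []; do !split=> //.
  rewrite /ev /= -/(ev w); apply: (short_mul) => //; apply: (Hc).
  by case: d; [left|right; left].
exists (length K * (2 * c + 1) + 1)%nat; split; first by lia.
move=> w z f f' Hf Hf' H.
have sf : short c f by apply: Hc; right; right.
have sf' : short c f' by apply: Hc; right; right.
have [s [Hs [Es Ls]]] : short (c + length w * c + c)%nat (ev z).
  case: H => H.
    have -> : ev z = inv f ** ev w ** f' by rewrite H; gsimp.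
    by do 2 apply: (short_mul) => //; apply: (short_inv).
  have -> : ev z = inv f' ** inv (ev w) ** f by rewrite H; gsimp.
  by do 2 apply: (short_mul) => //; apply: (short_inv).
have := word_length_le z s Hs Es; nia.
Qed.

End Matching.

(** * The quasimorphism counting occurrences of a word *)

Definition pattern (w : list bool) (x : G) : nat :=
  if dec (V x) then 1%nat else if dec (U (inv (ev w) ** x)) then 2%nat else 0%nat.

Definition pattern_sum (w : list bool) : G -> R := colour_sum (pattern w) omega12.

(** The colours change only at [K], the boundary of [V], and at its translate by [ev w], the
    boundary of [wU]; a connected hull of both serves. *)
Lemma pattern_clean w : exists Kw : list G, connected gens (fun x => In x Kw) /\ Kw <> [] /\
  clean gens (fun x => In x Kw) (pattern w).
Proof.
have [Kw [S [H1 C]]] := connected_hull gens gens_gen gens_inv (K ++ map (gmul G (ev w)) K).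
exists Kw; split=> //; split; first by case: (Kw) H1.
move=> x t Ht Kx Kt; rewrite /pattern (V_clean x t Ht); last first.
- by move=> H; apply: Kt; apply: S; apply: in_or_app; left.
- by move=> H; apply: Kx; apply: S; apply: in_or_app; left.
have S' y : ~ In y Kw -> ~ In (inv (ev w) ** y) K.
  move=> N H; apply: N; apply: S; apply: in_or_app; right; apply/in_map_iff.
  by exists (inv (ev w) ** y); split=> //; gsimp.
rewrite (U_clean (inv (ev w) ** x) t Ht (S' _ Kx)) -gmul_assoc //.
exact: S'.
Qed.

Lemma pattern_fwd w x h : fwd w x h -> omega12 (pattern w x) (pattern w (x ** h)) = 1.
Proof.
move=> [Vx Ux]; rewrite /pattern gmul_assoc.
have -> : dec (V x) = true by apply/decP.
have -> : dec (V (x ** h)) = false.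
  case E : dec => //; move/decP: E => H; case: (UV (x ** h)) => //.
  by have := ev_U w _ Ux; gsimp.
by have -> : dec (U (inv (ev w) ** x ** h)) = true by apply/decP.
Qed.

Lemma pattern_supp w x h : omega12 (pattern w x) (pattern w (x ** h)) <> 0 ->
  fwd w x h \/ bwd w x h.
Proof.
rewrite /pattern /fwd /bwd gmul_assoc.
case E1 : (dec (V x)); case E2 : (dec (V (x ** h))) => //;
  case E3 : (dec (U (inv (ev w) ** x))) => //; case E4 : (dec (U (inv (ev w) ** x ** h))) => //= _;
  solve [by left; split; apply/decP | by right; split; apply/decP].
Qed.

Lemma omega12_anti i j : omega12 i j = - omega12 j i.
Proof. by case: i => [|[|[|i]]]; case: j => [|[|[|j]]] /=; lra. Qed.

Lemma omega12_le1 i j : Rabs (omega12 i j) <= 1.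
Proof.
case: i => [|[|[|i]]]; case: j => [|[|[|j]]] /=;
  by rewrite ?Rabs_R0 ?Rabs_Ropp ?Rabs_R1; lra.
Qed.

Lemma pattern_sum_defect w : exists D, forall x y, Rabs (delta1 G (pattern_sum w) x y) <= D.
Proof.
have [Kw [C [N H]]] := pattern_clean w.
exists (3 * INR (length Kw * length Kw)) => x y.
exact: (colour_sum_defect gens gens_gen gens_inv _ _ Kw H omega12_anti omega12_le1).
Qed.

Lemma pattern_sum_eq0 w h :
  (forall x, ~ fwd w x h) -> (forall x, ~ bwd w x h) -> pattern_sum w h = 0.
Proof.
move=> Hf Hb; apply: fsum_eq0 => x; apply: NNPP => /pattern_supp[H|H].
  exact: (Hf x).
exact: (Hb x).
Qed.

Lemma pattern_sum_ge w h m : (forall x, ~ bwd w x h) -> NoDup m ->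
  (forall x, In x m -> fwd w x h) -> INR (length m) <= pattern_sum w h.
Proof.
move=> Hb Nm Hm; have [Kw [_ [_ H]]] := pattern_clean w.
have [l Sl] := colour_supp gens gens_gen _ omega12 Kw H omega12_anti h.
apply: (fsum_ge _ l) => // x; last by move=> /Hm /pattern_fwd ->; lra.
case: (Req_dec (omega12 (pattern w x) (pattern w (x ** h))) 0) => [->|]; first by lra.
by move=> /pattern_supp[/pattern_fwd ->|/Hb //]; lra.
Qed.

(** A word longer than a bound depending on [h] has no occurrence in either direction. This makes
    infinite combinations of counting quasimorphisms finite sums at every point. *)
Lemma pattern_sum_finite h : exists n, forall w, (n <= length w)%nat -> pattern_sum w h = 0.
Proof.
have [s [Hs ->]] := gens_gen h.
exists (length K * S (length s))%nat => w Hw; apply: pattern_sum_eq0 => x H.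
  by have := fwd_length w x s Hs H; lia.
by have := bwd_length w x s Hs H; lia.
Qed.

Lemma ev_pow_inj u i j : u <> [] -> ev (pow u i) = ev (pow u j) -> i = j.
Proof.
move=> Hu.
have H k l : (k < l)%nat -> ev (pow u k) <> ev (pow u l).
  move=> Hkl; have -> : l = (k + (1 + (l - k - 1)))%nat by lia.
  rewrite pow_add ev_app -{1}(mulg1 (ev (pow u k))) => E.
  case: (ev_neq1 (pow u (1 + (l - k - 1)))); last exact/eq_sym/mulg_lcancel/E.
  by case: (u) Hu.
move=> E; case: (Nat.lt_trichotomy i j) => [/H //|[//|/H]].
by rewrite E.
Qed.

Lemma hom_ev (phi : G -> R) w : (forall x y, phi (x ** y) = phi x + phi y) ->
  phi a = phi b -> phi (ev w) = INR (length w) * phi a.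
Proof.
move=> H Hab; have H1 : phi one = 0 by have := H one one; rewrite mulg1; lra.
elim: w => [|c w IH]; first by rewrite /ev /= H1; lra.
have Hc : phi (letter c) = phi a by case: c.
by rewrite ev_cons H IH Hc -[length (c :: w)]/(S (length w)) S_INR; ring.
Qed.

(** * Choice of the words by counting *)

Section Selection.
Variable F : list G.
Hypothesis F_cross : forall A : G -> Prop,
  clean gens (fun x => In x K) A -> forall y x, A x -> ~ A (x ** ev y) ->
  exists y1 y2, y = y1 ++ y2 /\ ~ A (x ** ev y1) /\ In (x ** ev y1) F.

(** All elements that can match a word of [Z] in the sense of [fwd_match] or, with the inverse, of
    [bwd_match]. *)
Definition near (Z : list (list bool)) : list G :=
  flat_map (fun z => flat_map (fun f => flat_map (fun f' =>
    [f ** ev z ** inv f'; f ** inv (ev z) ** inv f']) F) F) Z.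

Lemma length_near Z : (length (near Z) <= length Z * (length F * (length F * 2)))%nat.
Proof.
apply: length_flat_map_le => z _; apply: length_flat_map_le => f _.
exact: length_flat_map_le.
Qed.

Lemma in_near Z z f f' g : In z Z -> In f F -> In f' F ->
  g = f ** ev z ** inv f' \/ g = f ** inv (ev z) ** inv f' -> In g (near Z).
Proof.
move=> Hz Hf Hf' H; apply/in_flat_map; exists z; split=> //.
apply/in_flat_map; exists f; split=> //; apply/in_flat_map; exists f'; split=> //.
by case: H => ->; [left|right; left].
Qed.

(** Each [w] excludes at most [P] values of [v] and each [v] at most [P] values of [w], which makes
    at most [2P 2^h] bad pairs among [4^h]. Injectivity of [ev] on words of length [h] allows
    counting values instead of words. *)
Lemma good_pair h (L0 : list G) (L1 L2 : list bool -> list G) P :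
  (forall w, length w = h -> (length (L1 w) + length L0 <= P)%nat) ->
  (forall w, length w = h -> (length (L2 w) <= P)%nat) -> (2 * P < 2 ^ h)%nat ->
  exists v w, length v = h /\ length w = h /\
    ~ In (ev v) L0 /\ ~ In (ev v) (L1 w) /\ ~ In (ev w) (L2 v).
Proof.
move=> H1 H2 HP; apply: NNPP => N.
pose W := words h; pose e (p : list bool * list bool) := (ev (fst p), ev (snd p)).
pose B := flat_map (fun w => map (fun g => (g, ev w)) (L0 ++ L1 w)) W ++
  flat_map (fun v => map (fun g => (ev v, g)) (L2 v)) W.
have : (length (map e (list_prod W W)) <= length B)%nat.
  apply: NoDup_incl_length.
    apply: NoDup_map_NoDup_ForallPairs; last by apply: NoDup_list_prod; exact: NoDup_words.
    move=> [v w] [v' w'] /in_prod_iff[Hv Hw] /in_prod_iff[Hv' Hw'] [E1 E2].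
    by congr pair; apply: ev_inj => //; rewrite !(in_words h).
  move=> _ /in_map_iff[[v w] [<- /in_prod_iff[Hv Hw]]].
  have Hv' := in_words h v Hv; have Hw' := in_words h w Hw.
  apply: NNPP => N'; apply: N; exists v, w; split=> //; split=> //.
  split; [|split] => H; apply: N'; apply: in_or_app.
  - left; apply/in_flat_map; exists w; split=> //; apply/in_map_iff; exists (ev v).
    by split=> //; apply: in_or_app; left.
  - left; apply/in_flat_map; exists w; split=> //; apply/in_map_iff; exists (ev v).
    by split=> //; apply: in_or_app; right.
  right; apply/in_flat_map; exists v; split=> //; apply/in_map_iff; exists (ev w).
  by split.
rewrite length_map length_prod /B length_app.
have B1 : (length (flat_map (fun w => map (fun g => (g, ev w)) (L0 ++ L1 w)) W) <= length W * P)%nat.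
  apply: length_flat_map_le => w /in_words Hw.
  by rewrite length_map length_app; have := H1 w Hw; lia.
have B2 : (length (flat_map (fun v => map (fun g => (ev v, g)) (L2 v)) W) <= length W * P)%nat.
  by apply: length_flat_map_le => v /in_words Hv; rewrite length_map; exact: H2.
move: B1 B2; rewrite /W length_words; nia.
Qed.

(* The new element is u = v w a^M with M so long that an occurrence of v w along
   u meets only one copy of v w.  By [cut_factor], a reversed occurrence then
   determines v from w, or w from v, up to polynomially many choices. *)
Lemma select_word (prev : list (list bool)) n0 : (forall u, In u prev -> u <> []) ->
  exists w u, (n0 <= length w)%nat /\ u <> [] /\
    (forall u' k, In u' prev -> pattern_sum w (ev (pow u' k)) = 0) /\
    (forall k, INR (k - 1) <= pattern_sum w (ev (pow u k))).
Proof.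
move=> Hprev; have [C [C1 HC]] := match_length F.
pose f2 := (length F * (length F * 2))%nat.
have [B HB] : exists B, forall u, In u prev -> (length u <= B)%nat.
  elim: (prev) => [|u l [B HB]]; first by exists 0%nat.
  by exists (length u + B)%nat => u' [<-|/HB]; lia.
(* [A (h+1)^2] bounds twice the number of excluded values. The first summand counts factors of
   powers of the earlier words, of length below [(2BC+1)(h+1)]; the second counts factors of [w] or
   [v] with the run attached, of length below [(2C+2)(h+1)]. *)
pose A := (2 * (f2 * (length prev * ((2 * B * C + 1) * (2 * B * C + 1)) +
  ((2 * C + 2) * (2 * C + 2)))))%nat.
have [h [Hh Ah]] := quadratic_lt_exp A n0.
(* By [match_length], any word matching one of length [h] has length at most [L]. *)
pose L := (C * S h)%nat; pose run := repeat true (L + L).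
pose Z0 := flat_map (fun u => factors (pow u (S L))) prev.
have LZ0 : (length Z0 <= length prev * ((2 * B * C + 1) * (2 * B * C + 1) * (S h * S h)))%nat.
  apply: length_flat_map_le => u /HB Hu; apply: Nat.le_trans (length_factors _) _.
  rewrite length_pow.
  have : (S (S L * length u) <= (2 * B * C + 1) * S h)%nat by rewrite /L; nia.
  move: (S (S L * length u)) ((2 * B * C + 1))%nat => x y; nia.
have Lfac (l : list bool) : (length l = h + (L + L))%nat ->
    (length (factors l) <= (2 * C + 2) * (2 * C + 2) * (S h * S h))%nat.
  move=> Hl; apply: Nat.le_trans (length_factors _) _; rewrite Hl.
  have : (S (h + (L + L)) <= (2 * C + 2) * S h)%nat by rewrite /L; nia.
  move: (S (h + (L + L)))%nat (2 * C + 2)%nat => x y; nia.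
have LA : (2 * (f2 * length Z0 + f2 * ((2 * C + 2) * (2 * C + 2) * (S h * S h))) < 2 ^ h)%nat.
  apply: Nat.le_lt_trans Ah; rewrite /A.
  move: LZ0; move: (length Z0) ((2 * B * C + 1) * (2 * B * C + 1))%nat
    ((2 * C + 2) * (2 * C + 2))%nat (S h * S h)%nat (length prev) => x y z t p.
  by nia.
have B1 w : length w = h -> (length (near (factors (w ++ run))) + length (near Z0) <=
    f2 * length Z0 + f2 * ((2 * C + 2) * (2 * C + 2) * (S h * S h)))%nat.
  move=> Hw; have := length_near Z0; have := length_near (factors (w ++ run)).
  have := Lfac (w ++ run) ltac:(rewrite length_app repeat_length; lia).
  rewrite -/f2; move: (length (factors (w ++ run))); nia.
have B2 v : length v = h -> (length (near (factors (run ++ v))) <=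
    f2 * length Z0 + f2 * ((2 * C + 2) * (2 * C + 2) * (S h * S h)))%nat.
  move=> Hv; have := length_near (factors (run ++ v)).
  have := Lfac (run ++ v) ltac:(rewrite length_app repeat_length; lia).
  rewrite -/f2; move: (length (factors (run ++ v))); nia.
have [v [w [Hv [Hw [N0 [N1 N2]]]]]] := good_pair h (near Z0)
  (fun w => near (factors (w ++ run))) (fun v => near (factors (run ++ v))) _ B1 B2 LA.
pose u := v ++ w ++ run.
have L1 : (1 <= L)%nat by rewrite /L; nia.
have Hrun : run <> [] by rewrite /run; case: (L) L1 => //; lia.
have Hu : u <> [] by move=> /app_eq_nil[_ /app_eq_nil[_]].
have short z f f' : In f F -> In f' F ->
    ev v = f ** ev z ** inv f' \/ ev v = f ** inv (ev z) ** inv f' -> (length z <= L)%nat.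
  by rewrite /L -Hv; exact: HC.
exists (v ++ w), u; split; first by rewrite length_app; lia.
split=> //; split.
  (* An occurrence of [v w] along an earlier word contains a match of [v] alone, which [N0] excludes
     in both directions. *)
  move=> u' k Hu'; apply: pattern_sum_eq0 => x.
    move=> /fwd_prefix /(fwd_match F F_cross)[p [z [r [f [f' [E [Hf [Hf' Ez]]]]]]]].
    apply: N0; apply: (in_near _ z f f') => //; last by left.
    apply/in_flat_map; exists u'; split=> //; apply: factor_pow E _ _; first exact: Hprev.
    by apply: (short z f f') => //; left.
  move=> /bwd_prefix; rewrite -{1}(app_nil_r v).
  move=> /(bwd_match F F_cross)[p [z' [z [r [f [f' [f'' [E [Hf [Hf' [Hf'' [Ez _]]]]]]]]]]]].
  apply: N0; apply: (in_near _ z f f') => //; last by right.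
  rewrite app_assoc in E.
  apply/in_flat_map; exists u'; split=> //; apply: factor_pow E _ _; first exact: Hprev.
  by apply: (short z f f') => //; right.
(* Forward occurrences along [u^k] start at the inverses of [u^j] for [1 <= j < k]; [j = 0] is left
   out because the identity is not in [V]. *)
move=> k; rewrite -(length_seq (k - 1) 1) -(length_map (fun j => inv (ev (pow u j)))).
apply: pattern_sum_ge.
- move=> x /(bwd_match F F_cross)[p [z' [z [r [f [f' [f'' [E [Hf [Hf' [Hf'' [Ez Ez']]]]]]]]]]]].
  have [H|H] := cut_factor v w true h L k p z' z r Hv Hw E
    (short z f f' Hf Hf' (or_intror Ez))
    ltac:(rewrite /L -Hw; exact: (HC w z' f' f'' Hf' Hf'' (or_intror Ez'))).
  + by apply: N1; apply: (in_near _ z f f') => //; right.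
  + by apply: N2; apply: (in_near _ z' f' f'') => //; right.
- apply: NoDup_map_NoDup_ForallPairs; last exact: seq_NoDup.
  move=> i j _ _ E; apply: (ev_pow_inj u) => //.
  by rewrite -(invgK (ev (pow u i))) E invgK.
move=> _ /in_map_iff[j [<- /in_seq Hj]].
have Hpow i : (0 < i)%nat -> pow u i <> [].
  by case: i => [|i] Hi; [lia|rewrite /pow /= => /app_eq_nil[]].
split; first by rewrite -(mulg1 (inv _)); apply: ev_inv_V => //; apply: Hpow; lia.
have -> : k = (j + (1 + (k - j - 1)))%nat by lia.
have Eu : ev u = ev (v ++ w) ** ev run by rewrite /u app_assoc ev_app.
rewrite pow_add pow_add pow_1 (ev_app (pow u j)) (ev_app u) Eu; gsimp.
rewrite -ev_app -(mulg1 (ev _)); apply: ev_push => //.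
by move=> /app_eq_nil[].
Qed.

End Selection.
Lemma pattern_sequence : exists w u : nat -> list bool,
  (forall n, (n <= length (w n))%nat) /\
  (forall n k, pattern_sum (w n) (ev (pow [true] k)) = 0) /\
  (forall m n k, (m < n)%nat -> pattern_sum (w n) (ev (pow (u m) k)) = 0) /\
  (forall n k, INR (k - 1) <= pattern_sum (w n) (ev (pow (u n) k))).
Proof.
have [F F_cross] := cross_word.
pose good prev n (p : list bool * list bool) := (n <= length (fst p))%nat /\ snd p <> [] /\
  (forall u' k, In u' prev -> pattern_sum (fst p) (ev (pow u' k)) = 0) /\
  (forall k, INR (k - 1) <= pattern_sum (fst p) (ev (pow (snd p) k))).
pose pick prev n := epsilon (inhabits ([] : list bool, [] : list bool)) (good prev n).
(* The history starts with the word [a], so every later quasimorphism vanishes on the powers of [a]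
   as well. *)
pose hist := fix hist n := match n with
  | 0%nat => [[true]] | S n' => snd (pick (hist n') n') :: hist n' end.
have pickP prev n : (forall u, In u prev -> u <> []) -> good prev n (pick prev n).
  move=> H; apply: epsilon_spec; have [w [u Hwu]] := select_word F F_cross prev n H.
  by exists (w, u).
have histP n : forall u, In u (hist n) -> u <> [].
  elim: n => [|n IH] u /=; first by case=> [<-|[]].
  by case=> [<-|/IH //]; have [_ []] := pickP _ n IH.
have hist_true n : In [true] (hist n) by elim: n => [|n IH]; [left|right].
have hist_in m n : (m < n)%nat -> In (snd (pick (hist m) m)) (hist n).
  elim: n => [|n IH] H; first by lia.
  case: (Nat.eq_dec m n) => [->|N]; first by left.
  by right; apply: IH; lia.
exists (fun n => fst (pick (hist n) n)), (fun n => snd (pick (hist n) n)).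
split; first by move=> n; have [] := pickP _ n (histP n).
split; first by move=> n k; have [_ [_ [H _]]] := pickP _ n (histP n); exact: H.
split; last by move=> n k; have [_ [_ [_ H]]] := pickP _ n (histP n); exact: H.
move=> m n k Hmn; have [_ [_ [H _]]] := pickP _ n (histP n).
by apply: H; exact: hist_in.
Qed.

End Words.

(** * A triangular family of quasimorphisms *)

Definition independent_classes {I : Type} (G : Group) (e : I -> G -> G -> R) : Prop :=
  forall (l : list I) (c : I -> R), NoDup l ->
    bcoboundary2 G (lin_comb G l c e) -> forall t, In t l -> c t = 0.

Lemma lin_combE {I : Type} (G : Group) (l : list I) c e x y :
  lin_comb G l c e x y = lsum (fun i => c i * e i x y) l.
Proof. by []. Qed.

Lemma delta2_delta1 (G : Group) (f : G -> R) x y z : delta2 G (delta1 G f) x y z = 0.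
Proof. by rewrite /delta2 /delta1 !gmul_assoc; lra. Qed.

Lemma geometric_le s n : 0 < s < 1 -> lsum (fun k => s ^ k) (seq 0 n) <= / (1 - s).
Proof.
move=> Hs; have E : lsum (fun k => s ^ k) (seq 0 n) * (1 - s) = 1 - s ^ n.
  by elim: n => [|n IH]; [rewrite /=; lra|rewrite seq_S lsum_app /=; lra].
have P : 0 < s ^ n by apply: pow_lt; lra.
apply: (Rmult_le_reg_r (1 - s)); first by lra.
by rewrite E Rinv_l; lra.
Qed.

(** Subtracting [s x] times relation [n] from relation [n + 1] eliminates [x]. The coefficients
    [c i * (s i - s x)] satisfy the same relations on the shorter list, and finally the relation for
    [n = 0] isolates [c x]. *)
Lemma vandermonde {I : Type} (s : I -> R) (l : list I) c :
  (forall i j, s i = s j -> i = j) -> NoDup l ->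
  (forall n, lsum (fun i => c i * s i ^ n) l = 0) -> forall i, In i l -> c i = 0.
Proof.
move=> Hs; elim: l c => [|x l IH] c // /NoDup_cons_iff[Nx Nl] H.
have E n : lsum (fun i => c i * (s i - s x) * s i ^ n) l = 0.
  have H1 := H (S n); have H0 := H n; rewrite lsum_cons in H0; rewrite lsum_cons in H1.
  have -> : lsum (fun i => c i * (s i - s x) * s i ^ n) l =
      lsum (fun i => c i * (s i * s i ^ n)) l + - s x * lsum (fun i => c i * s i ^ n) l.
    by rewrite -lsum_scale -lsum_add; apply: lsum_ext => i _; ring.
  move: H0 H1 => /=; set A := lsum _ l; set B := lsum _ l => H0 H1.
  have -> : B = - (c x * (s x * s x ^ n)) by lra.
  have -> : A = - (c x * s x ^ n) by lra.
  by ring.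
have Z i : In i l -> c i = 0.
  move=> Hi; have /Rmult_integral[//|E'] := IH _ Nl E i Hi.
  by case: Nx; have <- : i = x by apply: Hs; lra.
move=> i [<-|/Z //]; have /= := H 0%nat.
rewrite (lsum_ext _ (fun _ => 0 * 1)); last by move=> j /Z ->; lra.
by rewrite lsum_scale; lra.
Qed.

Lemma bounded_multiples_eq0 x M : (forall k : nat, INR (k - 1) * Rabs x <= M) -> x = 0.
Proof.
move=> H; apply: NNPP => /Rabs_pos_lt P.
have [k Hk] := INR_unbounded (M / Rabs x).
have := H (S k); rewrite Nat.sub_succ Nat.sub_0_r.
have : M < INR k * Rabs x.
  have -> : M = M / Rabs x * Rabs x by field; lra.
  by apply: Rmult_lt_compat_r.
by lra.
Qed.

Section TriangularFamily.
Context {G : Group}.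
(** In the application [f n] counts the pattern of [w n], [p m k] is the [k]-th power of [u m], and
    [q k] the [k]-th power of [a]. *)
Variables (f : nat -> G -> R) (p : nat -> nat -> G) (q : nat -> G).
Hypothesis f_defect : forall n, exists D, forall x y, Rabs (delta1 G (f n) x y) <= D.
Hypothesis f_finite : forall h, exists N, forall n, (N <= n)%nat -> f n h = 0.
Hypothesis f_q : forall n k, f n (q k) = 0.
Hypothesis f_p : forall m n k, (m < n)%nat -> f n (p m k) = 0.
Hypothesis f_diag : forall n k, INR (k - 1) <= f n (p n k).
Hypothesis hom_p : forall phi : G -> R, (forall x y, phi (x ** y) = phi x + phi y) ->
  (exists M, forall k, Rabs (phi (q k)) <= M) -> forall m k, phi (p m k) = 0.

Lemma series_supp (t : nat -> R) h : exists N, forall M, (N <= M)%nat ->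
  supp_in (fun n => t n * f n h) (seq 0 M).
Proof.
have [N HN] := f_finite h; exists N => M HM n Hn; apply/in_seq; split; first by lia.
by apply: NNPP => L; apply: Hn; rewrite (HN n ltac:(lia)); lra.
Qed.

Definition series (t : nat -> R) (h : G) : R := fsum (fun n => t n * f n h).

Lemma series_combination {I : Type} (t : I -> nat -> R) c (l : list I) h :
  lsum (fun i => c i * series (t i) h) l = series (fun n => lsum (fun i => c i * t i n) l) h.
Proof.
elim: l => [|i l IH] /=.
  by rewrite /series fsum_eq0 // => n; lra.
have [N1 S1] := series_supp (t i) h.
have [N2 S2] := series_supp (fun n => lsum (fun i => c i * t i n) l) h.
rewrite IH /series -(fsum_scale _ _ _ (S1 N1 (Nat.le_refl _))).
rewrite -(fsum_add _ _ (seq 0 N1) (seq 0 N2)); last exact: S2.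
  by congr fsum; apply: functional_extensionality => n; ring.
move=> n Hn; apply: (S1 N1 (Nat.le_refl _)) => E; apply: Hn; rewrite E; lra.
Qed.

Lemma triangular_independent : exists e : R -> G -> G -> R,
  (forall x, bcocycle2 G (e x)) /\ independent_classes G e.
Proof.
have [D HD] : exists D : nat -> R, forall n, 0 < D n /\
    forall x y, Rabs (delta1 G (f n) x y) <= D n.
  apply: (choice (fun n d => 0 < d /\ forall x y, Rabs (delta1 G (f n) x y) <= d)) => n.
  have [d Hd] := f_defect n; exists (Rabs d + 1); have := Rabs_pos d.
  by split; [lra|move=> x y; have := Hd x y; have := Rle_abs d; lra].
(* An injection of the reals into the open interval from 0 to 1. *)
pose s x := / (1 + exp x).
have s01 x : 0 < s x < 1.
  have := exp_pos x; rewrite /s => Hx; split; first by apply: Rinv_0_lt_compat; lra.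
  by rewrite -Rinv_1; apply: Rinv_lt_contravar; lra.
have s_inj x y : s x = s y -> x = y.
  by move=> /Rinv_eq_reg E; apply: exp_inv; lra.
pose t x n := s x ^ n / D n.
exists (fun x => delta1 G (series (t x))); split.
  move=> x; split; last by move=> *; exact: delta2_delta1.
  exists (/ (1 - s x)) => g h.
  have [N1 S1] := series_supp (t x) g; have [N2 S2] := series_supp (t x) h.
  have [N3 S3] := series_supp (t x) (g ** h); pose M := (N1 + N2 + N3)%nat.
  rewrite /delta1 /series !(fsumE _ (seq 0 M)) ?seq_NoDup //;
    try by [apply: S1; lia|apply: S2; lia|apply: S3; lia|exact: seq_NoDup].
  have -> : forall A B C, A - B + C = A + (-1 * B + C) by move=> *; ring.
  rewrite -lsum_scale -!lsum_add.
  apply: Rle_trans (geometric_le _ M (s01 x)); apply: lsum_le => n.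
  have [D0 Dn] := HD n.
  have -> : t x n * f n h + (-1 * (t x n * f n (g ** h)) + t x n * f n g) =
      s x ^ n * (delta1 G (f n) g h / D n) by rewrite /t /delta1; field; lra.
  have P : 0 < s x ^ n by apply: pow_lt; have := s01 x; lra.
  rewrite Rabs_mult (Rabs_pos_eq (s x ^ n)); last by lra.
  rewrite -{2}(Rmult_1_r (s x ^ n)).
  apply: Rmult_le_compat_l; first by lra.
  rewrite /Rdiv Rabs_mult Rabs_inv (Rabs_pos_eq (D n)); last by lra.
  apply: (Rmult_le_reg_r (D n)) => //; rewrite Rmult_assoc Rinv_l; last by lra.
  by have := Dn g h; lra.
move=> l c Nl [beta [[M HM] Hbeta]].
pose tt n := lsum (fun i => c i * t i n) l.
(* The combination of the series and the bounded [beta] have the same coboundary, so their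
   difference is a homomorphism. *)
pose phi h := series tt h - beta h.
have phi_hom x y : phi (x ** y) = phi x + phi y.
  have := Hbeta x y; rewrite lin_combE.
  have -> : lsum (fun i => c i * delta1 G (series (t i)) x y) l =
      delta1 G (series tt) x y.
    rewrite /delta1 -!series_combination.
    have -> : forall A B C, A - B + C = A + (-1 * B + C) by move=> *; ring.
    by rewrite -lsum_scale -!lsum_add; apply: lsum_ext => i _; ring.
  by rewrite /delta1 /phi; lra.
have phi_p m k : phi (p m k) = 0.
  apply: hom_p => //; exists M => j.
  rewrite /phi /series fsum_eq0; last by move=> n; rewrite f_q; lra.
  by rewrite Rminus_0_l Rabs_Ropp.
(* On [p m k] the terms below [m] vanish by induction and those above by [f_p]. What remains equals
   the bounded [beta (p m k)], whereas [f m] grows linearly in [k]. *)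
have tt0 m : tt m = 0.
  induction m as [m IH] using (well_founded_induction Nat.lt_wf_0); apply: (bounded_multiples_eq0 _ M) => k.
  have E : series tt (p m k) = tt m * f m (p m k).
    rewrite /series (fsumE _ [m]) /=; first by lra.
      by apply: NoDup_cons => //; exact: NoDup_nil.
    move=> n Hn; left; case: (Nat.lt_trichotomy n m) => [H|[//|H]]; case: Hn.
      by rewrite IH //; lra.
    by rewrite f_p //; lra.
  have := phi_p m k; rewrite /phi E => E'; have := HM (p m k).
  have <- : tt m * f m (p m k) = beta (p m k) by lra.
  have := f_diag m k; have := pos_INR (k - 1); rewrite Rabs_mult => H1 H2.
  rewrite (Rabs_pos_eq (f m _)); last by lra.
  by have := Rabs_pos (tt m); nra.
apply: (vandermonde s) => // n.
have [D0 _] := HD n.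
have := tt0 n; rewrite /tt.
rewrite (lsum_ext _ (fun i => / D n * (c i * s i ^ n))); last by move=> i _; rewrite /t; field; lra.
rewrite lsum_scale => /Rmult_integral[E|//].
by have := Rinv_0_lt_compat _ D0; lra.
Qed.

End TriangularFamily.

(** * Bases of cardinality continuum *)

(** The part of [A] on which the Cantor-Bernstein bijection inverts [code]; elsewhere it is [e]. *)
Inductive unreached_orbit {A B : Type} (N : B -> Prop) (e : A -> B) (code : B -> A) : A -> Prop :=
| unreached_start c : N c -> (forall x, e x <> c) -> unreached_orbit N e code (code c)
| unreached_step x : unreached_orbit N e code x -> unreached_orbit N e code (code (e x)).

Lemma cantor_bernstein {A B : Type} (N : B -> Prop) (e : A -> B) (code : B -> A) :
  (forall x y, e x = e y -> x = y) -> (forall x, N (e x)) ->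
  (forall c d, code c = code d -> c = d) ->
  exists b : A -> B, (forall x y, b x = b y -> x = y) /\ (forall x, N (b x)) /\
    forall c, N c -> exists x, b x = c.
Proof.
move=> e_inj Ne code_inj; pose S := unreached_orbit N e code.
have Sc x : S x -> exists c, N c /\ code c = x.
  by case=> [c Nc _|y _]; [exists c|exists (e y)].
have bP x : exists c, N c /\ (S x /\ code c = x \/ ~ S x /\ c = e x).
  case: (classic (S x)) => Sx; last by exists (e x); split=> //; right.
  by have [c [Nc Ec]] := Sc x Sx; exists c; split=> //; left.
have [b Hb] := choice _ bP.
have mixed x y : S x -> ~ S y -> code (e y) = x -> False.
  move=> Sx; case: Sx => [c Nc Hc|z Sz] Sy /code_inj E; first exact: (Hc y).
  by apply: Sy; rewrite (e_inj _ _ E).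
exists b; split; [|split].
- move=> x y E; have [_ Hx] := Hb x; have [_ Hy] := Hb y; rewrite -E in Hy.
  case: Hx => -[Sx Ex]; case: Hy => -[Sy Ey].
  + by rewrite -Ex -Ey.
  + by case: (mixed x y) => //; rewrite -Ey.
  + by case: (mixed y x) => //; rewrite -Ex.
  + by apply: e_inj; rewrite -Ex -Ey.
- by move=> x; have [] := Hb x.
move=> c Nc; case: (classic (S (code c))) => Sx.
  by exists (code c); have [_ [[_ /code_inj]|[/(_ Sx)]]] := Hb (code c).
have [y Ey] : exists y, e y = c.
  by apply: NNPP => H; apply: Sx; apply: unreached_start => // y Ey; apply: H; exists y.
have Sy : ~ S y by move=> Sy; apply: Sx; rewrite -Ey; exact: unreached_step.
by exists y; have [_ [[/Sy]|[_ ->]]] := Hb y.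
Qed.

(** * Coding cochains on a countable group by reals *)

Definition ternary_term (d : nat -> bool) (i : nat) : R :=
  (if d i then 1 else 0) * (/ 3) ^ i.

Lemma ternary_sum_le (d : nat -> bool) n j :
  lsum (ternary_term d) (seq n j) <= 3 / 2 * (/ 3) ^ n - 3 / 2 * (/ 3) ^ (n + j).
Proof.
elim: j n => [|j IH] n; first by rewrite Nat.add_0_r /=; lra.
rewrite [seq n (S j)]/= lsum_cons; have := IH (S n); rewrite -Nat.add_succ_comm.
have P : 0 < (/ 3) ^ n by apply: pow_lt; lra.
by rewrite /ternary_term /=; case: (d n); lra.
Qed.

(** Ternary expansions with digits 0 and 1 only. At the first difference [n] one value gains [3^-n],
    while all later digits of the other add at most half of that. *)
Lemma bits_to_reals : exists L : (nat -> bool) -> R, forall d d', L d = L d' -> d = d'.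
Proof.
have P i : 0 < (/ 3) ^ i by apply: pow_lt; lra.
have ge0 d l : 0 <= lsum (ternary_term d) l.
  elim: l => [|i l IH]; first by rewrite /=; lra.
  by rewrite lsum_cons {1}/ternary_term; have := P i; case: (d i); lra.
pose E d r := exists n, r = lsum (ternary_term d) (seq 0 n).
have bd d : bound (E d).
  exists (3 / 2) => r [n ->]; have := ternary_sum_le d 0 n; have := P (0 + n)%nat.
  by rewrite /=; lra.
have ne d : exists r, E d r by exists 0, 0%nat.
exists (fun d => proj1_sig (completeness (E d) (bd d) (ne d))) => d d'.
case: completeness => x Hx; case: completeness => y Hy /= Exy; subst y.
apply: NNPP => Ndd.
have first_difference : exists n, d n <> d' n /\ forall i, (i < n)%nat -> d i = d' i.
  have [n0 H0] : exists n, d n <> d' n.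
    apply: NNPP => H; apply: Ndd; apply: functional_extensionality => i.
    by apply: NNPP => Hi; apply: H; exists i.
  induction n0 as [n IH] using (well_founded_induction Nat.lt_wf_0).
  case: (classic (exists i, (i < n)%nat /\ d i <> d' i)) => [[i [Hi Di]]|H]; first exact: (IH i).
  by exists n; split=> // i Hi; apply: NNPP => Di; apply: H; exists i.
have [n [Dn Di]] := first_difference.
have absurd_case c c' : (forall i, (i < n)%nat -> c i = c' i) -> c n = true -> c' n = false ->
    is_lub (E c) x -> is_lub (E c') x -> False.
  move=> Ei Ec Ec' [U _] [_ Lst].
  have Es : lsum (ternary_term c) (seq 0 n) = lsum (ternary_term c') (seq 0 n).
    by apply: lsum_ext => i /in_seq[_ Hi]; rewrite /ternary_term Ei.
  have HU : lsum (ternary_term c) (seq 0 (S n)) <= x by apply: U; exists (S n).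
  rewrite seq_S lsum_app lsum_cons {2}/ternary_term Ec Es in HU.
  have : x <= lsum (ternary_term c') (seq 0 n) + / 2 * (/ 3) ^ n.
    apply: Lst => r [m ->]; have Pn := P n.
    case: (Nat.le_gt_cases m n) => Hm.
      have -> : n = (m + (n - m))%nat by lia.
      rewrite seq_app lsum_app; have := ge0 c' (seq (0 + m) (n - m)).
      by have := P (m + (n - m))%nat; lra.
    have -> : m = (n + S (m - n - 1))%nat by lia.
    rewrite seq_app lsum_app [seq _ (S _)]/= lsum_cons {2}/ternary_term Ec'.
    have := ternary_sum_le c' (S n) (m - n - 1); have := P (S n + (m - n - 1))%nat.
    by rewrite [(/ 3) ^ S n]/=; lra.
  by have := P n; move: HU; rewrite Nat.add_0_l /=; lra.
case En : (d n) Dn => Dn; case En' : (d' n) Dn => Dn //.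
- exact: (absurd_case d d').
- by apply: (absurd_case d' d) => // i Hi; rewrite Di.
Qed.

(** Equal values of [up] force every multiple [l (x - y)] to be at most 1 in absolute value. A real
    is thus determined by a sequence of integers. *)
Lemma up_multiples_inj x y : (forall l : nat, up (INR l * x) = up (INR l * y)) -> x = y.
Proof.
move=> H; apply: Rminus_diag_uniq; apply: (bounded_multiples_eq0 _ 1) => k.
rewrite -(Rabs_pos_eq (INR _)); last exact: pos_INR.
rewrite -Rabs_mult Rmult_minus_distr_l.
have [A1 A2] := archimed (INR (k - 1) * x); have [B1 B2] := archimed (INR (k - 1) * y).
rewrite H in A1 A2; apply: Rabs_le; lra.
Qed.

Lemma to_nat_pair_inj (n m n' m' : nat) :
  to_nat (n, m) = to_nat (n', m') -> n = n' /\ m = m'.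
Proof. by move=> /to_nat_inj E; split; [exact: (f_equal fst E)|exact: (f_equal snd E)]. Qed.

Lemma real_sequences_to_reals : exists code : (nat -> nat -> R) -> R,
  forall c c', code c = code c' -> c = c'.
Proof.
have [L HL] := bits_to_reals.
pose enc n m l i j := to_nat (n, to_nat (m, to_nat (l, to_nat (i, j)))).
(* [Q c] is the graph of [(n, m, l) -> up (l * c n m)] as a set of naturals, each integer being
   given as a difference [i - j]. *)
pose Q (c : nat -> nat -> R) k := exists n m l i j,
  k = enc n m l i j /\ up (INR l * c n m) = (Z.of_nat i - Z.of_nat j)%Z.
exists (fun c => L (fun k => dec (Q c k))) => c c' /HL E.
apply: functional_extensionality => n; apply: functional_extensionality => m.
apply: up_multiples_inj => l.
pose z := up (INR l * c n m).
have Hz : z = (Z.of_nat (Z.to_nat z) - Z.of_nat (Z.to_nat (- z)))%Z by lia.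
have : Q c (enc n m l (Z.to_nat z) (Z.to_nat (- z))) by exists n, m, l, (Z.to_nat z), (Z.to_nat (- z)).
have /= Ek := f_equal (fun g => g (enc n m l (Z.to_nat z) (Z.to_nat (- z)))) E.
move=> /decP; rewrite Ek => /decP[n' [m' [l' [i' [j' [Eenc E']]]]]].
have [En Eenc1] := to_nat_pair_inj _ _ _ _ Eenc.
have [Em Eenc2] := to_nat_pair_inj _ _ _ _ Eenc1.
have [El Eenc3] := to_nat_pair_inj _ _ _ _ Eenc2.
have [Ei Ej] := to_nat_pair_inj _ _ _ _ Eenc3.
by rewrite -/z Hz Ei Ej -E' En Em El.
Qed.

Lemma enumeration {G : Group} (S : list G) : generates G S ->
  exists s : nat -> G, forall g, exists n, s n = g.
Proof.
move=> /sym_gens_gen H; pose gens := sym_gens S.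
pose ball := fix ball n := match n with
  | 0%nat => [one]
  | Datatypes.S n' => flat_map (fun t => map (gmul G t) (ball n')) gens end.
(* The index [k] codes a word length and a position among the products of that length; positions out
   of range give the default [one]. *)
exists (fun k => nth (snd (of_nat k)) (ball (fst (of_nat k))) one) => g.
have [l [Hl ->]] := H g.
have /(In_nth _ _ one)[i [_ Hi]] : In (gprod l) (ball (length l)).
  elim: l Hl => [|t l IH] Hl /=; first by left.
  apply/in_flat_map; exists t; split; first by apply: (Hl t); left.
  by apply: in_map; apply: IH => u Hu; apply: (Hl u); right.
by exists (to_nat (length l, i)); rewrite cancel_of_to.
Qed.

Lemma cochains_to_reals {G : Group} (S : list G) : generates G S ->
  exists code : (G -> G -> R) -> R, forall c c', code c = code c' -> c = c'.
Proof.
move=> /enumeration[s Hs]; have [code Hcode] := real_sequences_to_reals.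
exists (fun c => code (fun n m => c (s n) (s m))) => c c' /Hcode E.
apply: functional_extensionality => g; apply: functional_extensionality => h.
have [n <-] := Hs g; have [m <-] := Hs h.
exact: (f_equal (fun F => F n m) E).
Qed.

(** * From an independent family indexed by the reals to a basis *)

Section Dimension.
Context {G : Group}.
Local Notation cochain := (G -> G -> R).

Definition independent_set (N : cochain -> Prop) : Prop :=
  forall (l : list cochain) (c : cochain -> R), NoDup l -> (forall d, In d l -> N d) ->
    bcoboundary2 G (lin_comb G l c (fun d => d)) -> forall d, In d l -> c d = 0.

Lemma bcoboundary2_ext (c d : cochain) :
  (forall x y, c x y = d x y) -> bcoboundary2 G c -> bcoboundary2 G d.
Proof. by move=> E [f [Bf H]]; exists f; split=> // x y; rewrite -E. Qed.

Lemma bcoboundary2_0 : bcoboundary2 G (fun _ _ => 0).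
Proof.
exists (fun _ => 0); split; first by exists 0 => g; rewrite Rabs_R0; lra.
by move=> x y; rewrite /delta1; lra.
Qed.

Lemma bcoboundary2_scale k (c : cochain) :
  bcoboundary2 G c -> bcoboundary2 G (fun x y => k * c x y).
Proof.
move=> [f [[M HM] H]]; exists (fun x => k * f x); split.
  exists (Rabs k * M) => x; rewrite Rabs_mult.
  by apply: Rmult_le_compat_l; [exact: Rabs_pos|exact: HM].
by move=> x y; rewrite H /delta1; ring.
Qed.

(** Zorn's lemma for the sets [M] of cocycles with [E] and [M] jointly independent; in this form the
    empty chain has the empty set as its union. A finite list from the union of a chain already lies
    in [E] together with one member, or in [E] alone. *)
Lemma maximal_independent (E : cochain -> Prop) : independent_set E ->
  exists N : cochain -> Prop, (forall c, E c -> N c) /\ independent_set N /\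
    (forall c, N c -> E c \/ bcocycle2 G c) /\
    forall c, bcocycle2 G c -> ~ N c -> ~ independent_set (fun d => N d \/ d = c).
Proof.
move=> HE.
pose P (M : cochain -> Prop) :=
  (forall c, M c -> bcocycle2 G c) /\ independent_set (fun c => E c \/ M c).
have [M [[PM1 PM2] Mmax]] : exists M, P M /\ forall M', classical_sets.proper M M' -> ~ P M'.
  apply: classical_sets.Zorn_bigcup => F FP Ftot; split.
    by move=> c [X FX Xc]; apply: (proj1 (FP X FX)).
  move=> l c Nl Hl; have : (forall d, In d l -> E d) \/
      exists X, F X /\ forall d, In d l -> E d \/ X d.
    elim: l Hl {Nl} => [|d l IH] Hl; first by left.
    have Hd := Hl d (or_introl eq_refl).
    have {}IH := IH (fun d' H => Hl d' (or_intror H)).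
    case: Hd => [Ed|[Y FY Yd]].
      case: IH => [IH|[X [FX IH]]]; first by left=> d' [<-|/IH].
      by right; exists X; split=> // d' [<-|/IH //]; left.
    right; case: IH => [IH|[X [FX IH]]].
      by exists Y; split=> // d' [<-|/IH]; [right|left].
    case: (Ftot X Y FX FY) => XY.
      exists Y; split=> // d' [<-|/IH[|/XY]]; by [right|left].
    exists X; split=> // d' [<-|/IH //]; right; exact: XY.
  case=> [Hl'|[X [/FP[_ PX] HX]]]; first exact: HE.
  exact: PX.
exists (fun c => E c \/ M c); split; first by left.
split=> //; split; first by move=> c [|/PM1]; [left|right].
move=> c Hc Nc Hind; apply: (Mmax (fun d => M d \/ d = c)).
  split; first by left.
  by move=> H; apply: Nc; right; apply: H; right.
split; first by move=> d [/PM1|->].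
move=> l k Nl Hl; apply: Hind => // d /Hl; tauto.
Qed.

Lemma lin_comb_middle (l1 l2 : list cochain) d k x y :
  lin_comb G (l1 ++ d :: l2) k (fun d => d) x y =
  k d * d x y + lin_comb G (l1 ++ l2) k (fun d => d) x y.
Proof. by rewrite !lin_combE !lsum_app lsum_cons; ring. Qed.

(** A nontrivial relation must give [c] a nonzero coefficient, since [N] is independent; dividing by
    it expresses [c] through [N]. *)
Lemma maximal_spans (N : cochain -> Prop) c : independent_set N ->
  ~ independent_set (fun d => N d \/ d = c) ->
  exists (l : list cochain) (k : cochain -> R), NoDup l /\ (forall d, In d l -> N d) /\
    bcoboundary2 G (fun x y => c x y - lin_comb G l k (fun d => d) x y).
Proof.
move=> HN; rewrite /independent_set => Hdep; apply: NNPP => Hspan; apply: Hdep.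
move=> l k Nl Hl Hb.
case: (classic (In c l)) => Hc; last first.
  apply: HN => // d Hd; case: (Hl d Hd) => // E; by case: Hc; rewrite -E.
have [l1 [l2 El]] := in_split c l Hc; subst l.
have [Nl' Nc] : NoDup (l1 ++ l2) /\ ~ In c (l1 ++ l2).
  by split; [exact: NoDup_remove_1 Nl|exact: NoDup_remove_2 Nl].
have Hl' d : In d (l1 ++ l2) -> N d.
  move=> Hd; case: (Hl d).
  - by apply/in_app_iff; move/in_app_iff: Hd => [?|?]; [left|right; right].
  - by [].
  by move=> E; case: Nc; rewrite -E.
have kc : k c = 0.
  apply: NNPP => kc; apply: Hspan.
  exists (l1 ++ l2), (fun d => - / k c * k d); split=> //; split=> //.
  apply: (bcoboundary2_ext _ _ _ (bcoboundary2_scale (/ k c) _ Hb)) => x y.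
  rewrite lin_comb_middle !lin_combE.
  rewrite (lsum_ext (fun i => - / k c * k i * i x y) (fun i => - / k c * (k i * i x y))).
    by rewrite lsum_scale; field.
  by move=> i _; ring.
have Hb' : bcoboundary2 G (lin_comb G (l1 ++ l2) k (fun d => d)).
  by apply: bcoboundary2_ext Hb => x y; rewrite lin_comb_middle kc; ring.
move=> d /in_app_iff[Hd|[<- //|Hd]]; apply: (HN _ k Nl' Hl' Hb'); apply/in_app_iff;
  by [left|right].
Qed.

Lemma lin_comb_map {I : Type} (b : I -> cochain) (l : list I) k x y :
  lin_comb G (map b l) k (fun d => d) x y = lin_comb G l (fun i => k (b i)) b x y.
Proof. by rewrite !lin_combE lsum_map. Qed.

Lemma in_range_map {I : Type} (b : I -> cochain) (l : list cochain) :
  (forall d, In d l -> exists i, b i = d) -> exists l', l = map b l'.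
Proof.
elim: l => [|d l IH] H; first by exists [].
have [i <-] := H d (or_introl eq_refl).
have [|l' ->] := IH; first by move=> d' Hd'; apply: H; right.
by exists (i :: l').
Qed.

Lemma independent_injective {I : Type} (e : I -> cochain) :
  independent_classes G e -> forall x y, e x = e y -> x = y.
Proof.
move=> H x y E; apply: NNPP => Nxy.
pose k z := if dec (z = x) then 1 else -1.
have kx : k x = 1 by rewrite /k (proj2 (decP _)).
have ky : k y = -1.
  by rewrite /k; case D : dec => //; move/decP: D => D; case: Nxy.
have Nl : NoDup [x; y].
  apply: NoDup_cons; first by case=> [E'|[]]; case: Nxy.
  by apply: NoDup_cons => //; exact: NoDup_nil.
have Hb : bcoboundary2 G (lin_comb G [x; y] k e).
  by apply: bcoboundary2_ext bcoboundary2_0 => g h; rewrite /= kx ky E; lra.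
by have := H _ k Nl Hb x (or_introl eq_refl); rewrite kx; lra.
Qed.

Lemma independent_range {I : Type} (e : I -> cochain) :
  independent_classes G e -> independent_set (fun c => exists i, e i = c).
Proof.
move=> H l k Nl /in_range_map[l' El] Hb d; subst l => /in_map_iff[i [<- Hi]].
apply: (H l' (fun i => k (e i)) (NoDup_map_inv _ _ Nl)) => //.
by apply: bcoboundary2_ext Hb => x y; rewrite lin_comb_map.
Qed.

(** A maximal independent set [N] containing the family receives the injection [e] from the reals
    and is mapped back injectively by [code], so Cantor-Bernstein indexes it by the reals. *)
Theorem continuum_dimension (e : R -> cochain) (code : cochain -> R) :
  (forall x, bcocycle2 G (e x)) -> independent_classes G e ->
  (forall c d, code c = code d -> c = d) -> Hb2_dim_continuum G.
Proof.
move=> e_cocycle e_ind code_inj; have e_inj := independent_injective e e_ind.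
have [N [EN [Nind [Ncocycle Nmax]]]] := maximal_independent _ (independent_range e e_ind).
have [b [b_inj [bN b_onto]]] :=
  cantor_bernstein N e code e_inj (fun x => EN _ (ex_intro _ x eq_refl)) code_inj.
have cocycle c : N c -> bcocycle2 G c by move=> /Ncocycle[[x <-]|].
exists b; split; first by move=> x; exact: cocycle.
split.
  move=> l k Nl Hb t Ht.
  (* Coefficients indexed by reals become coefficients on cochains through the injection [b], with 0
     outside its range. *)
  have extend d : exists v, forall i, b i = d -> v = k i.
    case: (classic (exists i, b i = d)) => [[i <-]|H]; last by exists 0 => i Hi; case: H; exists i.
    by exists (k i) => j /b_inj ->.
  have [k' Ek'] := choice _ extend; have {}Hk' i : k' (b i) = k i by exact: Ek'.
  rewrite -Hk'; apply: (Nind (map b l) k') => //.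
  - by apply: NoDup_map_NoDup_ForallPairs Nl => x y _ _; exact: b_inj.
  - by move=> d /in_map_iff[i [<- _]].
  - apply: bcoboundary2_ext Hb => x y; rewrite lin_comb_map !lin_combE.
    by apply: lsum_ext => i _; rewrite Hk'.
  - exact: in_map.
move=> c Hc.
have [l [k [Nl [Hl Hb]]]] : exists (l : list cochain) (k : cochain -> R), NoDup l /\
    (forall d, In d l -> N d) /\
    bcoboundary2 G (fun x y => c x y - lin_comb G l k (fun d => d) x y).
  case: (classic (N c)) => Nc; last by apply: maximal_spans => //; exact: Nmax.
  exists [c], (fun _ => 1); split; first by apply: NoDup_cons => //; exact: NoDup_nil.
  split; first by move=> d [<-|[]].
  by apply: bcoboundary2_ext bcoboundary2_0 => x y; rewrite /=; lra.
have [l' El] := in_range_map b l (fun d Hd => b_onto d (Hl d Hd)).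
exists l', (fun i => k (b i)).
by apply: bcoboundary2_ext Hb => x y; rewrite El lin_comb_map.
Qed.

End Dimension.

(** * Combination of the ping-pong pair, the quasimorphisms and the cardinality bound *)

Theorem theorem3 (G : Group) :
  finitely_generated G ->
  (exists S : list G, generates G S /\ infinitely_many_ends G S) ->
  Hb2_dim_continuum G.
Proof.
move=> _ [S [HS HE]].
have [K [chi [K1 [K_conn [chi_clean [chi_K [chi_out chi_inf]]]]]]] := ends_colouring S HS HE.
have gens_gen := sym_gens_gen S HS; have gens_inv := sym_gens_inv S.
have [i [j [a [b [c [d [Nij [Hi [Hj [Ha [Hb [Ea [Eb dis]]]]]]]]]]]]] :=
  ping_pong_pair _ K chi gens_gen K1 K_conn chi_clean chi_out chi_inf.
pose U x := chi x = i; pose V x := chi x = j.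
have U_clean : clean (sym_gens S) (fun x => In x K) U.
  by move=> x t Ht Kx Kt; rewrite /U (chi_clean x t).
have V_clean : clean (sym_gens S) (fun x => In x K) V.
  by move=> x t Ht Kx Kt; rewrite /V (chi_clean x t).
have UV x : U x -> ~ V x by rewrite /U /V; congruence.
have U1 : ~ U one by rewrite /U (chi_K one K1); lia.
have V1 : ~ V one by rewrite /V (chi_K one K1); lia.
have [w [u [Hlen [Hq [Hp Hdiag]]]]] :=
  pattern_sequence _ K U V a b gens_gen gens_inv U_clean V_clean UV U1 V1 Ha Hb dis.
have [code code_inj] := cochains_to_reals S HS.
have defect n := pattern_sum_defect _ K U V a b gens_gen gens_inv U_clean V_clean (w n).
have finite h : exists N, forall n, (N <= n)%nat -> pattern_sum U V a b (w n) h = 0.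
  have [N HN] := pattern_sum_finite _ K U V a b gens_gen U_clean UV U1 V1 Ha Hb h.
  by exists N => n Hn; apply: HN; apply: Nat.le_trans Hn (Hlen n).
have hom_p (phi : G -> R) : (forall x y, phi (x ** y) = phi x + phi y) ->
    (exists M, forall k, Rabs (phi (ev a b (pow [true] k))) <= M) ->
    forall m k, phi (ev a b (pow (u m) k)) = 0.
  move=> phi_hom [M HM] m k.
  (* Since [a = c d] and [b = d c], a homomorphism depends only on the length of a positive word,
     and boundedness on the powers of [a] forces it to vanish. *)
  have phi_ab : phi a = phi b by rewrite Ea Eb !phi_hom; ring.
  rewrite (hom_ev _ _ _ _ phi_hom phi_ab).
  have -> : phi a = 0; last by ring.
  apply: (bounded_multiples_eq0 _ M) => n; have := HM (n - 1)%nat.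
  rewrite (hom_ev _ _ _ _ phi_hom phi_ab) length_pow Nat.mul_1_r Rabs_mult.
  by rewrite (Rabs_pos_eq (INR _)) //; exact: pos_INR.
have [e [e_cocycle e_ind]] := triangular_independent
  (fun n => pattern_sum U V a b (w n)) (fun m k => ev a b (pow (u m) k))
  (fun k => ev a b (pow [true] k)) defect finite Hq Hp Hdiag hom_p.
exact: continuum_dimension e_cocycle e_ind code_inj.
Qed.
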